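(* Let $\zeta>0$. Suppose that $\theta(h^\star)$ is identified, that $\sqrt{\log(K/\zeta)/n}=o(\widetilde\delta_n)$ and that $\sqrt{\log\log(1/\delta_N)/N}=o(\delta_N)$. Let $\widehat\xi$ be a minimizer over $\mathcal H$ of $\widehat R_{2,\mu}$, and let $\xi_0$ be the minimum-norm element of $\Xi_K$. Then, with probability $1-O(\zeta)$, $$\|\mathcal T_K(\widehat\xi-\xi_0)\|=\widetilde O\big(\delta_N^{1/2}+r^{\mathrm{new}}_{n_{\mathrm{new}}}+\sqrt\mu\big).$$
   Context: Data. $A$ takes values in $[K]=\{1,\dots,K\}$. For each $a\in[K]$ we observe $n$ ($n$ even) i.i.d. draws of $(S,Y)$ given $A=a$, independent across $a$: $N=nK$ historical observations $O_i=(A_i,S_i,Y_i)$. Expectations over $(A,S,Y)$ are with $A$ uniform on $[K]$. Each cell $\{i:A_i=a\}$ is split in two folds of size $n/2$; $V_i\in\{0,1\}$ is the fold of $i$ and $\mathcal D_0=\{O_i:V_i=0\}$. In addition we observe i.i.d. copies $S_1^{\mathrm{new}},\dots,S^{\mathrm{new}}_{n_{\mathrm{new}}}$ of $S^{\mathrm{new}}$, the short-term outcome under a novel treatment. Asymptotics are along $N=nK\to\infty$, $K\to\infty$; $\widetilde O$ hides logarithmic factors. Norms and operators. For $f(A,S,Y)$, $(\mathcal T_Kf)(a)=E[f(A,S,Y)\mid A=a]$, $\|f\|_{(a)}^2=E[f(a,S,Y)^2\mid A=a]$, $\|f\|^2=\frac1K\sum_a\|f\|_{(a)}^2$; $[\widehat{\mathcal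 T}_{K,v}f](a)=\frac2n\sum_{i:A_i=a,V_i=v}f(a,S_i,Y_i)$; $\|h\|_{2,N}^2=\frac1N\sum_{i=1}^Nh(S_i)^2$; $\|\xi\|_{\mathrm{new}}^2=E[\xi(S^{\mathrm{new}})^2]$. Class and target. $\mathcal H\subseteq L_2(S)$ is the hypothesis class; throughout $|Y|\le1$ and $\|h\|_\infty\le1$ for $h\in\mathcal H$. Let $\mathcal V$ be the closed linear span of $\mathcal H$ in $L_2(S)$; view $\mathcal T_K:\mathcal V\to\mathbb R^{[K]}$ with inner product $\frac1K\sum_af_1(a)f_2(a)$ on $\mathbb R^{[K]}$, and let $\mathcal T_K^*$ be its adjoint. $h^\star$ satisfies $E[h^\star(S)\mid A=a]=E[Y\mid A=a]$ for all $a\in[K]$; $\theta(h)=E[h(S^{\mathrm{new}})]$; $\alpha_K\in\mathcal V$ is the projection on $\mathcal V$ of the density ratio $\rho_K=p_{S^{\mathrm{new}}}/p_S\in L_2(S)$, so $\theta(h)=E[\alpha_K(S)h(S)]$ on $\mathcal V$. $\theta(h^\star)$ is identified if $\theta(h)=\theta(h^\star)$ for every $h$ in the nuisance space with $(\mathcal T_Kh)(a)=E[Y\mid A=a]$ for all $a$; this amounts to the existence of $\xi$ with $\mathcal T_K^*\mathcal T_K\xi=\alpha_K$, and $\Xi_K=\{\xi\in\mathcal H:\mathcal T_K^*\mathcal T_K\xi=\alpha_K\}$ is taken nonempty. Estimator risk. For $\mu>0$, $$\widehat R_{2,\mu}(\xi)=\frac1{2K}\sum_{a=1}^K[\widehat{\mathcal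 T}_{K,0}\xi](a)[\widehat{\mathcal T}_{K,1}\xi](a)-\frac1{n_{\mathrm{new}}}\sum_{i=1}^{n_{\mathrm{new}}}\xi(S_i^{\mathrm{new}})+\mu\|\xi\|_{2,N}^2.$$ Complexities. With i.i.d. Rademacher $\epsilon_i$ independent of the data, for a class $\mathcal F$ of functions of $(A,S)$: $\mathcal R_N(\mathcal F,\delta)=E[\sup_{f\in\mathcal F:\|f\|\le\delta}\frac2N\sum_{i:V_i=0}\epsilon_if(A_i,S_i)]$, $\mathcal R_{n,a}(\mathcal F,\delta)=E[\sup_{f\in\mathcal F:\|f\|_{(a)}\le\delta}\frac2n\sum_{i:A_i=a,V_i=0}\epsilon_if(A_i,S_i)]$, $\mathcal R_N^{|0}(\mathcal F,\delta)=E[\sup_{f\in\mathcal F:\|f\|\le\delta}\frac2N\sum_{i:V_i=1}\epsilon_if(A_i,S_i)\mid\mathcal D_0]$ ($\|\cdot\|$ conditional on $\mathcal D_0$). $\mathrm{star}(\mathcal F)=\{\gamma f:\gamma\in[0,1],f\in\mathcal F\}$. Fix $h_0\in\mathcal H$ with $E[Y-h_0(S)\mid A=a]=0$ for all $a$, and set $\mathcal G=\mathcal H-h_0$, $\mathcal G^0=\{g(S)-(\mathcal T_Kg)(A):g\in\mathcal G\}$, $\mathcal G^1=\{g(S)(\mathcal T_Kg)(A):g\in\mathcal G\}$, $\mathcal T_K\mathcal G=\{(\mathcal T_Kg)(A):g\in\mathcal G\}$, $\widehat{\mathcal G}=\{g(A,S)(\widehat{\mathcal T}_{K,0}g)(A):g\in\mathcal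 G^0\}$. $\widetilde\delta_N,\bar\delta_N,\breve\delta_N$ solve $\mathcal R_N(\mathrm{star}(\mathcal F),\delta)\le\delta^2$ for $\mathcal F=\mathcal G^0,\mathcal G^1,\mathcal T_K\mathcal G$; $\widetilde\delta_n$ solves $\mathcal R_{n,a}(\mathrm{star}(\mathcal G^0),\delta)\le\delta^2$ for every $a$; $\widehat\delta_N$ solves $\mathcal R_N^{|0}(\mathrm{star}(\widehat{\mathcal G}),\delta)\le\delta^2$; $\delta_N=\max(\widetilde\delta_N,\widehat\delta_N,\bar\delta_N,\breve\delta_N)$. $\mathcal R^{\mathrm{new}}(\mathcal H,\delta)=E[\sup_{\xi\in\mathcal H:\|\xi\|_{\mathrm{new}}\le\delta}\frac1{n_{\mathrm{new}}}\sum_{i=1}^{n_{\mathrm{new}}}\epsilon_i\xi(S_i^{\mathrm{new}})]$, and $(r^{\mathrm{new}}_{n_{\mathrm{new}}})^2$ is an upper bound on $\mathcal R^{\mathrm{new}}(\mathcal H,1)$. *)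

(* Defs.v *)
From HB Require Import structures.
From mathcomp Require Import all_boot all_order all_algebra.
From mathcomp Require Import all_classical all_reals all_analysis.
Import Order.TTheory GRing.Theory Num.Theory.
Import numFieldNormedType.Exports.

Set Implicit Arguments.
Unset Strict Implicit.
Unset Printing Implicit Defensive.

Local Open Scope classical_set_scope.
Local Open Scope ring_scope.

(* (S_i, Y_i) for the i-th draw of arm a; the treatment A_i = a is the outer
   index of the table. *)
Definition sample {dS} (Sp : measurableType dS) (R : realType) (K n : nat) :=
  K.-tuple (n.-tuple (Sp * R)%type).

Definition obs {dS} {Sp : measurableType dS} {R : realType} {K n : nat}
  (x : sample Sp R K n) (a : 'I_K) (i : 'I_n) : Sp * R := tnth (tnth x a) i.

(* One term of the triangular array. [law a] is the law of (S, Y) given A = a,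
   and [fold a i] is V_i, with [false] for 0 and [true] for 1. *)
Record experiment (R : realType) dS (Sp : measurableType dS) := Experiment {
  arms : nat;
  draws : nat;
  new_draws : nat;
  law : 'I_arms -> probability (Sp * R)%type R;
  law_new : probability Sp R;
  fold : 'I_arms -> 'I_draws -> bool;
  dOmega : measure_display;
  Omega : measurableType dOmega;
  Pr : probability Omega R;
  data : {RV Pr >-> sample Sp R arms draws};
  data_new : {RV Pr >-> new_draws.-tuple Sp} }.

Section Outer_expectation.
Context {R : realType} {d} {Omega : measurableType d} (P : probability Omega R).
Context {d'} {T : measurableType d'} (X : {RV P >-> T}) (I : finType).

Local Notation signs := {ffun I -> bool}.

Definition rad (e : signs) (i : I) : R := (-1) ^+ (e i).

Definition sign_mean (u : signs -> R) : R :=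
  (#|{: signs}|%:R)^-1 * \sum_(e : signs) u e.

Definition majorant (F U : signs -> T -> R) : Prop :=
  forall e : signs,
    [/\ measurable_fun setT (U e),
        P.-integrable setT (EFin \o (U e \o X)) &
        forall x : T, F e x <= U e x].

(* E[F(eps, X)] for eps uniform on {-1, 1}^I (i.i.d. Rademacher signs)
   independent of X. The suprema below range over uncountable classes, so this
   is the outer expectation with respect to the joint law of (eps, X), as usual
   for empirical processes; it is the expectation when F is measurable. *)
Definition rad_expectation (F : signs -> T -> R) : \bar R :=
  ereal_inf [set (sign_mean (fun e => \int[P]_w U e (X w)))%:E
            | U in majorant F].

(* Outer conditional expectation: E[F(eps, X) | D_0] <= b(X) almost surely. Here
   [join x x'] takes its D_0-coordinates from x and the others from x'; as the
   two blocks of coordinates are independent, conditioning on D_0 integrates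
   over the second block with the first one frozen. *)
Definition rad_cond_expectation_le (join : T -> T -> T)
    (F : signs -> T -> R) (b : T -> R) : Prop :=
  exists2 U, majorant F U &
    {ae P, forall w,
      ((#|{: signs}|%:R)^-1%:E *
       (\sum_(e : signs) \int[P]_w' (U e (join (X w) (X w')))%:E)
         <= (b (X w))%:E)%E}.

End Outer_expectation.

Unset Implicit Arguments.

Section Model.
Context {R : realType} {dS} {Sp : measurableType dS} (E : experiment R Sp).

Local Notation K := (arms E).
Local Notation n := (draws E).
Local Notation nnew := (new_draws E).
Local Notation smp := (sample Sp R K n).

(* Functions f(A, S, Y). *)
Definition fun_of_obs := 'I_K -> Sp * R -> R.

Definition ofS (h : Sp -> R) : fun_of_obs := fun _ z => h z.1.

Definition nobs : nat := n * K.

Definition split_sampling : Prop :=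
  [/\ ~~ odd n, (0 < n)%N, (0 < nnew)%N &
      forall (a : 'I_K) (v : bool), #|[pred i | fold a i == v]| = n./2].

(* The joint law of the table is the product of the laws of its cells: the
   draws of arm a are i.i.d. with law [law a], and independent across arms. *)
Definition iid_data : Prop :=
  forall B : 'I_K -> 'I_n -> set (Sp * R),
    (forall a i, measurable (B a i)) ->
    Pr E [set w | forall a i, B a i (obs (data E w) a i)]
      = (\prod_(a < K) \prod_(i < n) law a (B a i))%E.

Definition iid_new : Prop :=
  forall B : 'I_nnew -> set Sp,
    (forall i, measurable (B i)) ->
    Pr E [set w | forall i, B i (tnth (data_new E w) i)]
      = (\prod_(i < nnew) law_new E (B i))%E.

Definition outcome_bounded : Prop :=
  forall a : 'I_K, {ae law a, forall z, `|z.2| <= 1}.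

Definition TK (f : fun_of_obs) (a : 'I_K) : R := \int[law a]_z f a z.

Definition meanA (u : 'I_K -> R) : R := K%:R^-1 * \sum_(a < K) u a.

(* Expectation over (A, S, Y) with A uniform on the arms. *)
Definition Expect (f : fun_of_obs) : R := meanA (TK f).

Definition normA (u : 'I_K -> R) : R := Num.sqrt (meanA (fun a => u a ^+ 2)).

Definition norm_arm (a : 'I_K) (f : fun_of_obs) : R :=
  Num.sqrt (\int[law a]_z (f a z) ^+ 2).

Definition norm_obs (f : fun_of_obs) : R :=
  Num.sqrt (meanA (fun a => norm_arm a f ^+ 2)).

Definition norm_new (h : Sp -> R) : R :=
  Num.sqrt (\int[law_new E]_s (h s) ^+ 2).

Definition That (v : bool) (x : smp) (f : fun_of_obs) (a : 'I_K) : R :=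
  2 / n%:R * \sum_(i < n | fold a i == v) f a (obs x a i).

Definition sq_norm_emp (x : smp) (h : Sp -> R) : R :=
  nobs%:R^-1 * \sum_(a < K) \sum_(i < n) h (obs x a i).1 ^+ 2.

Definition theta (h : Sp -> R) : R := \int[law_new E]_s h s.

(* The space L_2(S), S having its marginal law with A uniform; its elements are
   functions, and equality in it is [eqL2]. *)
Definition L2S : set (Sp -> R) :=
  [set h | forall a : 'I_K, (fun z => h z.1) \in Lfun (law a) 2%:E].

Definition eqL2 (h h' : Sp -> R) : Prop :=
  forall a : 'I_K, {ae law a, forall z, h z.1 = h' z.1}.

Definition bounded_class (H : set (Sp -> R)) : Prop :=
  forall h, H h -> measurable_fun setT h /\ forall s, `|h s| <= 1.

Definition lin_span (H : set (Sp -> R)) : set (Sp -> R) :=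
  [set w | exists k (c : 'I_k -> R) (h : 'I_k -> Sp -> R),
     (forall j, H (h j)) /\ w = (fun s => \sum_(j < k) c j * h j s)].

Definition closed_span (H : set (Sp -> R)) : set (Sp -> R) :=
  [set w | L2S w /\ forall eps, 0 < eps ->
     exists2 v, lin_span H v & norm_obs (ofS (fun s => w s - v s)) < eps].

(* rho = p_new / p_S: the law of S^new has density rho with respect to the
   marginal law of S. *)
Definition density_ratio (rho : Sp -> R) : Prop :=
  [/\ L2S rho, forall s, 0 <= rho s &
      forall B, measurable B ->
        law_new E B = (Expect (ofS (fun s => \1_B s * rho s)))%:E].

Definition is_projection (V : set (Sp -> R)) (rho alpha : Sp -> R) : Prop :=
  V alpha /\
  forall v, V v -> Expect (ofS (fun s => (rho s - alpha s) * v s)) = 0.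

Definition is_adjoint (V : set (Sp -> R)) (Tstar : ('I_K -> R) -> Sp -> R) :
  Prop :=
  forall u, V (Tstar u) /\
    forall v, V v ->
      Expect (ofS (fun s => Tstar u s * v s)) = meanA (fun a => u a * TK (ofS v) a).

Definition bridges (h : Sp -> R) : Prop :=
  forall a : 'I_K, TK (ofS h) a = TK (fun _ z => z.2) a.

Definition identified (V : set (Sp -> R)) (hstar : Sp -> R) : Prop :=
  forall h, V h -> bridges h -> theta h = theta hstar.

Definition Xi (H : set (Sp -> R)) (Tstar : ('I_K -> R) -> Sp -> R)
    (alpha : Sp -> R) : set (Sp -> R) :=
  [set xi | H xi /\ eqL2 (Tstar (TK (ofS xi))) alpha].

Definition min_norm_in (X : set (Sp -> R)) (xi0 : Sp -> R) : Prop :=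
  X xi0 /\ forall xi, X xi -> norm_obs (ofS xi0) <= norm_obs (ofS xi).

Definition risk (mu : R) (x : smp) (y : nnew.-tuple Sp) (xi : Sp -> R) : R :=
  (2 * K%:R)^-1 *
    (\sum_(a < K) That false x (ofS xi) a * That true x (ofS xi) a)
  - nnew%:R^-1 * (\sum_(i < nnew) xi (tnth y i))
  + mu * sq_norm_emp x xi.

Definition minimizes_risk (mu : R) (H : set (Sp -> R)) (x : smp)
    (y : nnew.-tuple Sp) (xi : Sp -> R) : Prop :=
  H xi /\ forall xi', H xi' -> risk mu x y xi <= risk mu x y xi'.

Definition star (F : set fun_of_obs) : set fun_of_obs :=
  [set f | exists (g : R) f', [/\ 0 <= g, g <= 1, F f' &
     f = (fun a z => g * f' a z)]].

Local Notation cell := ('I_K * 'I_n)%type.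

Definition rad_sup_fold (v : bool) (F : set fun_of_obs) (delta : R)
    (e : {ffun cell -> bool}) (x : smp) : R :=
  sup [set 2 / nobs%:R *
        \sum_(a < K) \sum_(i < n | fold a i == v)
          rad e (a, i) * f a (obs x a i)
      | f in F `&` [set f | norm_obs f <= delta]].

Definition rad_sup_arm (a : 'I_K) (F : set fun_of_obs) (delta : R)
    (e : {ffun cell -> bool}) (x : smp) : R :=
  sup [set 2 / n%:R *
        \sum_(i < n | fold a i == false) rad e (a, i) * f a (obs x a i)
      | f in F `&` [set f | norm_arm a f <= delta]].

Definition rad_sup_new (H : set (Sp -> R)) (delta : R)
    (e : {ffun 'I_nnew -> bool}) (y : nnew.-tuple Sp) : R :=
  sup [set nnew%:R^-1 * \sum_(i < nnew) rad e i * xi (tnth y i)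
      | xi in H `&` [set xi | norm_new xi <= delta]].

Definition complexity (F : set fun_of_obs) (delta : R) : \bar R :=
  rad_expectation (data E) (rad_sup_fold false F delta).

Definition complexity_arm (a : 'I_K) (F : set fun_of_obs) (delta : R) : \bar R :=
  rad_expectation (data E) (rad_sup_arm a F delta).

Definition complexity_new (H : set (Sp -> R)) (delta : R) : \bar R :=
  rad_expectation (data_new E) (rad_sup_new H delta).

Definition same_D0 (x x' : smp) : Prop :=
  forall a i, fold a i = false -> obs x a i = obs x' a i.

Definition D0_measurable (b : smp -> R) : Prop :=
  measurable_fun setT b /\ forall x x', same_D0 x x' -> b x = b x'.

(* D_0 from x, the other fold from x'. *)
Definition join_folds (x x' : smp) : smp :=
  [tuple [tuple if fold a i then obs x' a i else obs x a i | i < n] | a < K].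

(* The class may depend on D_0, and so do delta and the bound b. *)
Definition complexity_cond0_le (F : smp -> set fun_of_obs)
    (delta b : smp -> R) : Prop :=
  rad_cond_expectation_le (data E) join_folds
    (fun e x => rad_sup_fold true (F x) (delta x) e x) b.

Definition Gclass (H : set (Sp -> R)) (h0 : Sp -> R) : set fun_of_obs :=
  [set ofS (fun s => h s - h0 s) | h in H].

Definition G0 (H : set (Sp -> R)) (h0 : Sp -> R) : set fun_of_obs :=
  [set (fun a z => g a z - TK g a) | g in Gclass H h0].

Definition G1 (H : set (Sp -> R)) (h0 : Sp -> R) : set fun_of_obs :=
  [set (fun a z => g a z * TK g a) | g in Gclass H h0].

Definition TG (H : set (Sp -> R)) (h0 : Sp -> R) : set fun_of_obs :=
  [set (fun a _ => TK g a) | g in Gclass H h0].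

Definition Ghat (H : set (Sp -> R)) (h0 : Sp -> R) (x : smp) : set fun_of_obs :=
  [set (fun a z => g a z * That false x g a) | g in G0 H h0].

Definition solves (F : set fun_of_obs) (delta : R) : Prop :=
  0 < delta /\ (complexity (star F) delta <= (delta ^+ 2)%:E)%E.

Definition solves_arms (F : set fun_of_obs) (delta : R) : Prop :=
  0 < delta /\
  forall a, (complexity_arm a (star F) delta <= (delta ^+ 2)%:E)%E.

(* The conditional complexity is a function of D_0, hence so is its critical
   radius. *)
Definition solves_cond0 (F : smp -> set fun_of_obs) (delta : smp -> R) : Prop :=
  [/\ D0_measurable delta, forall x, 0 < delta x &
      complexity_cond0_le (fun x => star (F x)) delta (fun x => delta x ^+ 2)].

End Model.

(* Main.v *)
Require Import Defs.
From HB Require Import structures.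
From mathcomp Require Import all_boot all_order all_algebra.
From mathcomp Require Import all_classical all_reals all_analysis.
From mathcomp Require Import measurable_realfun ring lra.
Import Order.TTheory GRing.Theory Num.Theory.
Import numFieldNormedType.Exports.
Local Open Scope classical_set_scope.
Local Open Scope ring_scope.

(** Population risk. With [T] the operator [TK] and [xi0] in [Xi], the projection
    of the density ratio and the adjoint give [theta h = <T xi0, T h>] on the
    class, the inner product being the mean over the arms ([theta_inner]). So
    [|T (xi - xi0)|^2] is twice the excess at [xi] of the population risk
    [|T xi|^2 / 2 - theta xi]. As [xihat] has a smaller empirical risk than
    [xi0], this excess is at most the sum of the fluctuations of the empirical
    risk at [xihat] and at [xi0], plus [mu] ([minimizer_gap]). It remains to
    bound these fluctuations uniformly over the class by a multiple of
    [delta_N + rnew ^ 2 + mu]; the square root then gives the stated rate.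

    Confidence. [zeta] is fixed while [N] grows, so [ln (N / zeta)] eventually
    exceeds [1 / zeta]: the logarithmic factor pays for bounds that degrade like
    [1 / zeta]. Each fluctuation is therefore handled in expectation, by
    symmetrization, and then by Markov's inequality ([symmetrization]); eight
    such events are intersected, whence [c = 8]. The suprema may fail to be
    measurable, so all the expectations are taken on measurable majorants, and
    the symmetrization inequality is proved pointwise on them before being
    integrated.

    From radii to rates. A class bounded by [b], with localized complexity at
    most [delta ^ 2] at radius [delta], has a global complexity at most
    [b * delta]: multiplication by [delta / b] maps it into the ball of radius
    [delta] of its star hull ([star_rad_sup]). Each fluctuation is hence of
    order [delta / zeta].

    The two-fold product. Put [g = xi - h0], write [x_v = That_v g - T g] and
    [Y_v = That_v h0], and let [y_v = Y_v - T h0]. Up to a term that does not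
    depend on [xi], [That_0 xi * That_1 xi - (T xi) ^ 2] is
      [x_0 x_1 + T g (x_0 + x_1) + (Y_1 x_0 + Y_0 x_1) + T g (y_0 + y_1)]
    ([fold_product_expansion]). Given the other fold, each of the seven means is
    a centred empirical process over one fold, indexed by [Ghat], [G1], [G0] and
    [TG] respectively. The multipliers are bounded: [Y_v] is a function of the
    other fold and [y_v] averages the noise of [h0], which is independent of
    [g]. Multipliers in [[-1, 1]] do not increase a Rademacher average, because
    such a multiplier is the mean of a random sign ([rad_contraction]). The
    class [Ghat] and its radius depend on [D_0]; dividing the class by its
    radius turns the conditional bound into an unconditional one
    ([rad_controlled_of_majorant]). Fold 1 has the same law as fold 0, so the
    radii of fold 0 serve for both ([rad_controlled_fold]).

    The new sample. The class contains [xi0], and centring it at [xi0] makes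
    the suprema nonnegative without changing their mean over the signs
    ([rad_controlled_new]); the bound [rnew ^ 2] is then global at once, as
    every element of the class has norm at most 1. *)

Set Implicit Arguments.
Unset Strict Implicit.
Unset Printing Implicit Defensive.

Local Notation rad := Defs.rad.

(** * Samples with independent coordinates *)

Definition box {T Z I} (c : I -> T -> Z) (B : I -> set Z) : set T :=
  [set x | forall i, B i (c i x)].

Definition splice {T Z I} (c : I -> T -> Z) (mk : (I -> Z) -> T)
    (m : I -> bool) (x x' : T) : T :=
  mk (fun i => if m i then c i x' else c i x).

Definition relabel {T Z I} (c : I -> T -> Z) (mk : (I -> Z) -> T)
    (s : I -> I) (x : T) : T :=
  mk (fun i => c (s i) x).

(** Both the table of historical observations and the tuple of new ones are
    samples with independent coordinates. The coordinates [c] and the assembly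
    [mk] are kept abstract so that the two cases, whose carriers are nested and
    plain tuples, are treated at once. [c_gen] says that the sigma-algebra is
    generated by the coordinates. *)
Record product_sample {R : realType} {dT dZ} {T : measurableType dT}
    {Z : measurableType dZ} {I : finType} (c : I -> T -> Z)
    (mk : (I -> Z) -> T) (p : I -> probability Z R) (mu : probability T R) :
    Prop := ProductSample {
  mkK : forall f i, c i (mk f) = f i;
  c_meas : forall i, measurable_fun setT (c i);
  c_gen : forall d' (T' : measurableType d') (f : T' -> T),
    (forall i, measurable_fun setT (c i \o f)) -> measurable_fun setT f;
  mu_box : forall B, (forall i, measurable (B i)) ->
    mu (box c B) = (\prod_i p i (B i))%E }.

Section Product_sample.
Context {R : realType} {dT dZ} {T : measurableType dT} {Z : measurableType dZ}
  {I : finType} {c : I -> T -> Z} {mk : (I -> Z) -> T}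
  {p : I -> probability Z R} {mu : probability T R}.
Hypothesis S : product_sample c mk p mu.

Lemma measurable_box B : (forall i, measurable (B i)) -> measurable (box c B).
Proof.
move=> mB; rewrite (_ : box c B = \big[setI/setT]_(i : I) (c i @^-1` B i)).
  apply: bigsetI_measurable => i _.
  by rewrite -[_ @^-1` _]setTI; exact: (c_meas S).
rewrite -bigcap_seq; apply/seteqP; split=> x /= Bx i; first by move=> _; exact: Bx.
exact/Bx/mem_index_enum.
Qed.

(** Boxes form a pi-system that generates the sigma-algebra, by [c_gen] applied
    to the identity from the sigma-algebra generated by the boxes. *)
Lemma box_unique (nu : {measure set T -> \bar R}) :
  (forall B, (forall i, measurable (B i)) ->
     nu (box c B) = (\prod_i p i (B i))%E) ->
  forall A, measurable A -> nu A = mu A.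
Proof.
move=> nuB A mA.
pose G := [set X | exists2 B, (forall i, measurable (B i)) & X = box c B].
have G_meas : G `<=` measurable by move=> _ [B mB ->]; exact: measurable_box.
have GT : G setT by exists (fun=> setT) => //; apply/seteqP; split.
apply: (@g_sigma_algebra_measure_unique _ _ _ G _ (fun=> setT)) => //.
- by rewrite bigcup_const//; exists 0%N.
- move=> _ _ [B mB ->] [B' mB' ->]; exists (fun i => B i `&` B' i).
    by move=> i; exact: measurableI.
  apply/seteqP; split=> [x [Bx B'x] i|x BB'x]; first by split; [exact: Bx|exact: B'x].
  by split=> i; have [] := BB'x i.
- by move=> _ [B mB ->]; rewrite nuB//; exact/esym/(mu_box S).
- move=> _; rewrite (_ : setT = box c (fun=> setT)) ?nuB//; last exact/seteqP.
  by rewrite big1 ?ltry// => i _; exact: probability_setT.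
- have /(_ measurableT _ mA) : measurable_fun (setT : set (g_sigma_algebraType G))
    (id : g_sigma_algebraType G -> T); last by rewrite setTI.
  apply: (c_gen S) => i _ B mB; rewrite setTI; apply: sub_sigma_algebra.
  exists (fun j => if j == i then B else setT).
    by move=> j; case: ifP.
  apply/seteqP; split=> [x Bx j /=|x /(_ i)/=]; last by rewrite eqxx.
  by case: eqP => // ->.
Qed.

(** The form in which [box_unique] is used: a change of variables under any map
    that sends boxes to the right mass. *)
Lemma product_law d' (T' : measurableType d') (P : {measure set T' -> \bar R})
    (f : T' -> T) (g : T -> \bar R) :
  measurable_fun setT f ->
  (forall B, (forall i, measurable (B i)) ->
     P (f @^-1` box c B) = (\prod_i p i (B i))%E) ->
  measurable_fun setT g -> (forall x, 0 <= g x)%E ->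
  (\int[P]_x g (f x) = \int[mu]_x g x)%E.
Proof.
move=> mf PB mg g0.
rewrite -[RHS](@eq_measure_integral _ _ _ _ _ (pushforward P f)); last first.
  by move=> A mA _; exact: (box_unique (nu := pushforward P f)).
by rewrite [RHS]ge0_integral_pushforward// preimage_setT.
Qed.

Lemma c_splice m x x' i : c i (splice c mk m x x') = if m i then c i x' else c i x.
Proof. by rewrite (mkK S). Qed.

Lemma measurable_splice m : measurable_fun setT (fun z : T * T => splice c mk m z.1 z.2).
Proof.
apply: (c_gen S) => i /=.
rewrite (_ : _ \o _ = if m i then c i \o snd else c i \o fst).
  by case: (m i); apply: measurableT_comp (c_meas S i) _.
by apply/funext => z /=; rewrite c_splice; case: (m i).
Qed.

(** Exchanging some coordinates with those of an independent copy preserves the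
    law. This is both the swap of symmetrization and, when the mask is a fold,
    the disintegration of the law along the two folds. *)
Lemma splice_law m (g : T -> \bar R) :
  measurable_fun setT g -> (forall x, 0 <= g x)%E ->
  (\int[mu]_x \int[mu]_x' g (splice c mk m x x') = \int[mu]_x g x)%E.
Proof.
move=> mg g0.
have ms := measurable_splice m.
transitivity (\int[mu \x mu]_z g (splice c mk m z.1 z.2))%E.
  by rewrite fubini_tonelli1//; exact: (measurableT_comp mg ms).
apply: (product_law ms) => // B mB.
pose B1 i := if m i then setT else B i.
pose B2 i := if m i then B i else setT.
rewrite (_ : _ @^-1` _ = box c B1 `*` box c B2).
  have mB1 i : measurable (B1 i) by rewrite /B1; case: ifP.
  have mB2 i : measurable (B2 i) by rewrite /B2; case: ifP.
  transitivity (mu (box c B1) * mu (box c B2))%E.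
    by apply: product_measure1E; exact: measurable_box.
  rewrite !(mu_box S)// -big_split/=; apply: eq_bigr => i _.
  by rewrite /B1 /B2; case: ifP => _; rewrite probability_setT ?mule1 ?mul1e.
apply/seteqP; split=> [z /= Bz|z [/= B1z B2z] i]; last first.
  by rewrite c_splice; have := B1z i; have := B2z i; rewrite /B1 /B2; case: (m i).
by split=> i; have := Bz i; rewrite c_splice /B1 /B2; case: (m i).
Qed.

Lemma c_relabel s x i : c i (relabel c mk s x) = c (s i) x.
Proof. exact: (mkK S). Qed.

Lemma measurable_relabel s : measurable_fun setT (relabel c mk s).
Proof.
apply: (c_gen S) => i; rewrite (_ : _ \o _ = c (s i)); first exact: (c_meas S).
by apply/funext => x /=; rewrite c_relabel.
Qed.

Lemma relabel_law s (g : T -> \bar R) :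
  involutive s -> (forall i, p (s i) = p i) ->
  measurable_fun setT g -> (forall x, 0 <= g x)%E ->
  (\int[mu]_x g (relabel c mk s x) = \int[mu]_x g x)%E.
Proof.
move=> sK ps mg g0; apply: (product_law (measurable_relabel s)) => // B mB.
rewrite (_ : _ @^-1` _ = box c (B \o s)).
  apply: (etrans (mu_box S _)); first by move=> i /=.
  rewrite [RHS](reindex_inj (inv_inj sK))/=.
  by apply: eq_bigr => i _; rewrite ps.
apply/seteqP; split=> x /= Bx i /=.
  by have := Bx (s i); rewrite c_relabel sK.
by rewrite c_relabel; have := Bx (s i); rewrite /= sK.
Qed.

Lemma coord_law i (f : Z -> R) : measurable_fun setT f ->
  (exists b, forall z, `|f z| <= b) ->
  (\int[mu]_x (f (c i x))%:E = \int[p i]_z (f z)%:E)%E.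
Proof.
move=> mf [b fb]; have mc := c_meas S i.
rewrite -[RHS](@eq_measure_integral _ _ _ _ _ (pushforward mu (c i))).
  rewrite [RHS]integral_pushforward//.
  - exact/measurable_EFinP.
  - rewrite preimage_setT; apply: measurable_bounded_integrable => //.
    + by rewrite -ge0_fin_numE// fin_num_measure.
    + exact: measurableT_comp mf (c_meas S i).
    + exists b; split; first by rewrite num_real.
      by move=> y yb x _ /=; exact/(le_trans (fb _))/ltW.
move=> A mA _; pose B j := if j == i then A else setT.
transitivity (mu (box c B)); last first.
  rewrite (mu_box S); last by move=> j; rewrite /B; case: ifP.
  rewrite (bigD1 i)//= /B eqxx big1 ?mule1// => j /negPf ->.
  exact: probability_setT.
congr (mu _); apply/seteqP; split=> [x Ax j|x /(_ i)].
  by rewrite /B; case: eqP => // ->.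
by rewrite /B eqxx.
Qed.

End Product_sample.

(** * Random signs *)

Section Signs.
Context {R : realType} {I : finType}.
Implicit Types (e s : {ffun I -> bool}) (w : I -> R).

Definition flip_signs s e : {ffun I -> bool} := [ffun i => s i (+) e i].

Lemma flip_signsK s : involutive (flip_signs s).
Proof. by move=> e; apply/ffunP => i; rewrite !ffunE addbA addbb. Qed.

Lemma rad_flip s e i : rad (flip_signs s e) i = rad s i * rad e i :> R.
Proof. by rewrite /rad ffunE signr_addb. Qed.

Lemma sum_flip s (u : {ffun I -> bool} -> R) :
  \sum_e u (flip_signs s e) = \sum_e u e.
Proof. by rewrite [RHS](reindex_inj (inv_inj (flip_signsK s))). Qed.

Definition opp_signs e : {ffun I -> bool} := flip_signs [ffun=> true] e.

Lemma rad_opp e i : rad (opp_signs e) i = - rad e i :> R.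
Proof. by rewrite rad_flip /rad ffunE expr1 mulN1r. Qed.

Lemma sum_opp (u : {ffun I -> bool} -> R) : \sum_e u (opp_signs e) = \sum_e u e.
Proof. exact: sum_flip. Qed.

(** The law of independent signs with means [w i]. *)
Definition sign_law w s : R := \prod_i ((1 + rad s i * w i) / 2).

Lemma sign_law_ge0 w s : (forall i, `|w i| <= 1) -> 0 <= sign_law w s.
Proof.
move=> w1; apply: prodr_ge0 => i _; apply: divr_ge0 => //.
rewrite -[_ + _]opprK oppr_ge0 opprD subr_le0 -[_ * _]opprK.
by rewrite opprK lerNl (le_trans (ler_norm _))// normrN normrM normr_sign mul1r.
Qed.

Lemma sum_sign_law w : \sum_s sign_law w s = 1.
Proof.
rewrite /sign_law -(bigA_distr_bigA (fun i b => (1 + (-1) ^+ nat_of_bool b * w i) / 2)).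
apply: big1 => i _; rewrite big_bool/= expr1 expr0; lra.
Qed.

(** [rad s k] times the product is a product too, in which the factor of index
    [k] has sum [w k] and every other one has sum 1. *)
Lemma mean_sign_law w k : \sum_s sign_law w s * rad s k = w k.
Proof.
pose G i (b : bool) : R :=
  (1 + (-1) ^+ nat_of_bool b * w i) / 2 * (if i == k then (-1) ^+ nat_of_bool b else 1).
transitivity (\prod_i \sum_b G i b).
  rewrite bigA_distr_bigA; apply: eq_bigr => s _; rewrite big_split/=; congr *%R.
  by rewrite (bigD1 k)//= eqxx big1 ?mulr1// => i /negPf ->.
rewrite (bigD1 k)//= [X in _ * X]big1 ?mulr1; last first.
  by move=> i /negPf ik; rewrite big_bool /G ik/= expr1 expr0; lra.
by rewrite big_bool /G eqxx/= expr1 expr0; lra.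
Qed.

End Signs.

(** * Rademacher bounds through measurable majorants *)

(** A bound [kappa] on the mean over the signs and the sample of the supremum,
    over the class, of the absolute Rademacher sum on the coordinates in [D].
    The class may depend on the sample. The supremum is replaced by measurable
    majorants [U e], whose sum over the signs is all that the integral bound
    constrains; this makes the bound stable under any operation that permutes
    or averages the signs pointwise. *)
Definition rad_controlled {R : realType} {dT dZ} {T : measurableType dT}
    {Z : measurableType dZ} {I : finType} (c : I -> T -> Z)
    (mu : probability T R) (D : pred I) (F : T -> set (I -> Z -> R))
    (kappa : R) : Prop :=
  exists U : {ffun I -> bool} -> T -> R,
  [/\ forall e, measurable_fun setT (U e),
      forall e x, 0 <= U e x,
      forall x f e, F x f ->
        `|\sum_(i | D i) rad e i * f i (c i x)| <= U e x &
      (\int[mu]_x (\sum_e U e x)%:E <=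
         (#|{: {ffun I -> bool}}|%:R * kappa)%:E)%E].

Section Rademacher.
Context {R : realType} {dT dZ} {T : measurableType dT} {Z : measurableType dZ}
  {I : finType} {c : I -> T -> Z} {mk : (I -> Z) -> T}
  {p : I -> probability Z R} {mu : probability T R}.
Hypothesis S : product_sample c mk p mu.
Implicit Types (D : pred I) (F : T -> set (I -> Z -> R)).

(** A weight in [[-1, 1]] is the mean of a random sign with law [sign_law], so
    the weighted Rademacher sum is a mean of sums for modified signs. For each
    value of these signs the modification permutes the sign vectors: the sum
    of the majorants over [e] is unchanged at every point of the sample, and
    the weights may be arbitrary functions of it. *)
Lemma rad_contraction D F F' kappa (w : T -> I -> R) :
  (forall i, measurable_fun setT (w ^~ i)) ->
  (forall x i, `|w x i| <= 1) ->
  (forall x f', F' x f' ->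
     exists2 f, F x f & forall i, D i -> f' i (c i x) = w x i * f i (c i x)) ->
  rad_controlled c mu D F kappa -> rad_controlled c mu D F' kappa.
Proof.
move=> mw w1 F'F [U [mU U0 UF Uk]].
exists (fun e x => \sum_s sign_law (w x) s * U (flip_signs s e) x); split.
- move=> e; apply: measurable_sum => s; apply: measurable_funM => //.
  apply: measurable_prod => i _; apply: measurable_funM => //.
  by apply: measurable_funD => //; exact: measurable_funM.
- by move=> e x; apply: sumr_ge0 => s _; rewrite mulr_ge0// sign_law_ge0.
- move=> x f' e /F'F[f Ff f'f].
  rewrite (_ : \sum_(i | D i) _ = \sum_s sign_law (w x) s *
      \sum_(i | D i) rad (flip_signs s e) i * f i (c i x)).
    apply: (le_trans (ler_norm_sum _ _ _)); apply: ler_sum => s _.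
    rewrite normrM ger0_norm ?sign_law_ge0//.
    by rewrite ler_wpM2l ?sign_law_ge0//; exact: UF.
  under [RHS]eq_bigr do rewrite big_distrr/=.
  rewrite exchange_big/=; apply: eq_bigr => i Di.
  rewrite f'f// -[w x i](mean_sign_law (w x)) mulrA big_distrr/= big_distrl/=.
  by apply: eq_bigr => s _; rewrite rad_flip; ring.
- rewrite (eq_integral (fun x => (\sum_e U e x)%:E))//= => x _.
  congr EFin; rewrite exchange_big/=.
  under eq_bigr do rewrite -big_distrr/= (sum_flip _ (U ^~ x)).
  by rewrite -big_distrl/= sum_sign_law mul1r.
Qed.

(** Used to carry a bound from fold 0, where the complexities are defined, to
    fold 1. *)
Lemma rad_relabel D D' F F' kappa (s : I -> I) :
  involutive s -> (forall i, p (s i) = p i) ->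
  (forall i, D' i = D (s i)) ->
  (forall x f', F' x f' ->
     exists2 f, F (relabel c mk s x) f & forall i, D i -> f' (s i) = f i) ->
  rad_controlled c mu D F kappa -> rad_controlled c mu D' F' kappa.
Proof.
move=> sK ps D'D F'F [U [mU U0 UF Uk]].
pose es (e : {ffun I -> bool}) := [ffun i => e (s i)] : {ffun I -> bool}.
have esK : involutive es by move=> e; apply/ffunP => i; rewrite !ffunE sK.
exists (fun e x => U (es e) (relabel c mk s x)); split=> //.
- by move=> e; apply: measurableT_comp (mU _) (measurable_relabel S s).
- move=> x f' e /F'F[f Ff f'f].
  rewrite (reindex_inj (inv_inj sK))/= (eq_bigl D); last first.
    by move=> i; rewrite D'D sK.
  apply: le_trans (UF _ _ (es e) Ff).
  rewrite le_eqVlt; apply/orP; left; apply/eqP; congr `| _ |.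
  apply: eq_bigr => i Di; rewrite f'f// (c_relabel S).
  by rewrite /rad ffunE.
- pose g x := (\sum_e U e x)%:E.
  rewrite (eq_integral (fun x => g (relabel c mk s x))); last first.
    by move=> x _; rewrite /g; congr EFin; rewrite [RHS](reindex_inj (inv_inj esK)).
  rewrite (relabel_law S)//.
    by apply/measurable_EFinP; exact: measurable_sum.
  by move=> x; rewrite lee_fin sumr_ge0.
Qed.

End Rademacher.

(** * Symmetrization *)

Section Symmetrization.
Context {R : realType} {dT dZ} {T : measurableType dT} {Z : measurableType dZ}
  {I : finType} {c : I -> T -> Z} {mk : (I -> Z) -> T}
  {p : I -> probability Z R} {mu : probability T R}.
Hypothesis S : product_sample c mk p mu.
Implicit Types (D : pred I) (F : T -> set (I -> Z -> R)).

Lemma markov_event (B : T -> \bar R) (b zeta : R) :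
  measurable_fun setT B -> (forall x, 0 <= B x)%E -> 0 < b -> 0 < zeta ->
  (\int[mu]_x B x <= b%:E)%E ->
  exists A, [/\ measurable A, ((1 - zeta)%:E <= mu A)%E &
    forall x, A x -> (B x <= (b / zeta)%:E)%E].
Proof.
move=> mB B0 b0 z0 iB; have bz0 : 0 < b / zeta by rewrite divr_gt0.
pose N := [set x | ((b / zeta)%:E <= `|B x|)%E].
have mN : measurable N.
  by rewrite -[N]setTI; apply: emeasurable_fun_c_infty => //; exact: measurableT_comp.
exists (~` N); split; first exact: measurableC.
  rewrite probability_setC// EFinB leeB//.
  have := @le_integral_comp_abse _ _ _ mu _ measurableT B (b / zeta) id
    (@measurable_id _ _ _) (fun _ => id) (fun _ _ _ _ => id) mB bz0.
  rewrite setTI -/N => le1.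
  have {le1} : ((b / zeta)%:E * mu N <= b%:E)%E.
    apply: (le_trans le1); rewrite (eq_integral B)//= => x _.
    by rewrite gee0_abs.
  have muN : mu N \is a fin_num by exact: fin_num_measure.
  rewrite -(fineK muN) -EFinM !lee_fin -ler_pdivlMl// => /le_trans; apply.
  by rewrite invf_div divfK ?gt_eqF.
move=> x /negP; rewrite /N/= -ltNge gee0_abs// => /ltW; exact.
Qed.

Lemma bounded_integrable d' (X : measurableType d') (P : probability X R)
    (f : X -> R) (b : R) :
  measurable_fun setT f -> (forall x, `|f x| <= b) ->
  P.-integrable setT (EFin \o f).
Proof.
move=> mf fb; apply: measurable_bounded_integrable => //.
  by rewrite -ge0_fin_numE// fin_num_measure.
exists b; split; first by rewrite num_real.
by move=> y yb x _ /=; exact/(le_trans (fb _))/ltW.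
Qed.

(** The deviation at [x] is the mean over an independent copy [x'] of the
    difference between the two empirical sums. *)
Lemma centred_as_integral D (f : I -> Z -> R) x :
  (forall i, measurable_fun setT (f i) /\ exists b, forall z, `|f i z| <= b) ->
  let h x' := \sum_(i | D i) (f i (c i x) - f i (c i x')) in
  mu.-integrable setT (EFin \o h) /\
  (\int[mu]_x' (h x')%:E =
   (\sum_(i | D i) (f i (c i x) - \int[p i]_z f i z))%:E)%E.
Proof.
move=> fP h.
pose k i x' : R := if D i then f i (c i x) - f i (c i x') else 0.
have intfc i : mu.-integrable setT (EFin \o (f i \o c i)).
  have [mf [b fb]] := fP i; apply: (@bounded_integrable _ _ _ _ b) => //.
    exact: measurableT_comp mf (c_meas S i).
  by move=> y; exact: fb.
have intcst r : mu.-integrable setT (EFin \o cst r).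
  by apply: (@bounded_integrable _ _ _ _ `|r|) => // y; exact: measurable_cst.
have intk i : mu.-integrable setT (EFin \o k i).
  rewrite /k; case: (D i); last exact: intcst.
  by rewrite (_ : EFin \o _ = (EFin \o cst (f i (c i x))) \- (EFin \o (f i \o c i)))%E//; exact: integrableB.
have hk : EFin \o h = fun x' => (\sum_i (EFin \o k i) x')%E.
  by apply/funext => x' /=; rewrite sumEFin /h big_mkcond.
split; first by rewrite hk; exact: integrable_sum.
rewrite -/(EFin \o h) (eq_integral (fun x' => \sum_i (EFin \o k i) x')%E); last first.
  by move=> x' _; rewrite -[LHS]/((EFin \o h) x') hk.
rewrite integral_sum// [in RHS]big_mkcond -sumEFin; apply: eq_bigr => i _.
rewrite /k; case: (D i) => /=; last by rewrite integral0.
have [mf [b fb]] := fP i.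
under eq_integral do rewrite EFinB.
rewrite integralB//; [|exact: intcst|exact: intfc].
rewrite integral_cst// [X in (_ * X)%E](_ : _ = 1%E); last exact: probability_setT.
rewrite mule1 (coord_law S)//; last by exists b.
rewrite EFinB; congr (_ - _)%E.
by rewrite /Rintegral fineK//; apply: integrable_fin_num => //; exact: bounded_integrable fb.
Qed.

(** For every sign vector [e], the difference between the sums at [x] and [x']
    is the sum of the Rademacher sums for [e] at the sample with the
    coordinates [e] exchanged, and for the opposite signs at the sample with
    the other coordinates exchanged. Averaging over [e] bounds it by twice the
    mean of [U e] at exchanged samples, which have the law of the sample. The
    exchanges only touch the coordinates in [D], on which the class is assumed
    not to depend. Markov's inequality concludes. *)
Lemma symmetrization D F kappa zeta : 0 < kappa -> 0 < zeta ->
  (forall x f i, F x f ->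
     measurable_fun setT (f i) /\ exists b, forall z, `|f i z| <= b) ->
  (forall x x' (m : I -> bool) f, (forall i, m i -> D i) ->
     F x f -> F (splice c mk m x x') f) ->
  rad_controlled c mu D F kappa ->
  exists A, [/\ measurable A, ((1 - zeta)%:E <= mu A)%E &
    forall x f, A x -> F x f ->
      `|\sum_(i | D i) (f i (c i x) - \int[p i]_z f i z)| <= 2 * kappa / zeta].
Proof.
move=> k0 z0 FP FD [U [mU U0 UF Uk]].
pose n := #|{: {ffun I -> bool}}|.
have n0 : 0 < n%:R :> R.
  by rewrite ltr0n; apply/card_gt0P; exists [ffun=> true].
pose s (e : {ffun I -> bool}) := splice c mk (fun i => D i && e i).
pose G x x' := \sum_e U e (s e x x').
have G0 x x' : 0 <= G x x' by rewrite sumr_ge0.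
have diff_le x x' f : F x f ->
    n%:R * `|\sum_(i | D i) (f i (c i x) - f i (c i x'))| <= 2 * G x x'.
  move=> Ff; set d := `|_|.
  have dU e : d <= U e (s e x x') + U (opp_signs e) (s (opp_signs e) x x').
    rewrite /d (_ : \sum_(i | D i) _ =
      \sum_(i | D i) rad e i * f i (c i (s e x x')) +
      \sum_(i | D i) rad (opp_signs e) i * f i (c i (s (opp_signs e) x x'))).
      by apply: (le_trans (ler_normD _ _)); apply: lerD; apply: UF; apply: FD => // i /andP[].
    rewrite -big_split/=; apply: eq_bigr => i Di.
    rewrite rad_opp !(c_splice S) Di/= !ffunE/= /rad.
    by case: (e i) => /=; rewrite ?expr1 ?expr0; ring.
  have /le_trans : \sum_(e : {ffun I -> bool}) d <=
      \sum_e (U e (s e x x') + U (opp_signs e) (s (opp_signs e) x x')) by exact: ler_sum.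
  rewrite sumr_const mulr_natl; apply.
  rewrite big_split/= (sum_opp (fun e => U e (s e x x'))).
  by rewrite -/(G x x') mulr2n mulrDl mul1r.
have ms e := measurableT_comp (mU e) (measurable_splice S (fun i => D i && e i)).
have msE e : measurable_fun setT (fun z : T * T => (U e (s e z.1 z.2))%:E).
  by apply/measurable_EFinP; exact: ms.
have msF e : measurable_fun setT (fun x => \int[mu]_x' (U e (s e x x'))%:E)%E.
  have := @measurable_fun_fubini_tonelli_F _ _ T T R mu _ (msE e).
  by apply => z; rewrite lee_fin.
have msr e x : measurable_fun setT (fun x' => U e (s e x x')).
  exact: measurableT_comp (ms e) (measurable_pair1 x).
have msx e x : measurable_fun setT (fun x' => (U e (s e x x'))%:E).
  exact/measurable_EFinP.
pose B x := (\sum_e \int[mu]_x' (U e (s e x x'))%:E)%E.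
have BE x : B x = (\int[mu]_x' (G x x')%:E)%E.
  rewrite /B -ge0_integral_sum//.
    by apply: eq_integral => x' _; rewrite sumEFin.
  by move=> e x' _; rewrite lee_fin.
have [] := @markov_event B (n%:R * kappa) zeta.
- exact: emeasurable_sum.
- by move=> x; apply: sume_ge0 => e _; apply: integral_ge0 => x' _; rewrite lee_fin.
- by rewrite mulr_gt0.
- by [].
- apply: le_trans Uk; rewrite /B ge0_integral_sum//; last first.
    by move=> e x _; apply: integral_ge0 => x' _; rewrite lee_fin.
  under [leRHS]eq_integral do rewrite -sumEFin.
  rewrite ge0_integral_sum//; last 2 first.
  + by move=> e; exact/measurable_EFinP.
  + by move=> e x _; rewrite lee_fin.
  apply: lee_sum => e _; rewrite (splice_law S _ (g := fun x => (U e x)%:E))//.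
    exact/measurable_EFinP.
  by move=> x; rewrite lee_fin.
move=> A [mA PA AB]; exists A; split=> // x f Ax Ff.
have [inth hE] := @centred_as_integral D f x (fun i => FP x f i Ff).
rewrite -lee_fin -abse_EFin -hE.
apply: (le_trans (le_abse_integral _ measurableT _)).
  exact: measurable_int inth.
apply: (@le_trans _ _ (\int[mu]_x' ((2 / n%:R) * G x x')%:E)%E).
  apply: ge0_le_integral => //.
  - by apply: measurableT_comp => //; exact: measurable_int inth.
  - apply/measurable_EFinP; apply: measurable_funM => //.
    by apply: measurable_sum => e; exact: msr.
  - move=> x' _ /=; rewrite lee_fin mulrAC ler_pdivlMr// mulrC.
    exact: diff_le.
under eq_integral do rewrite EFinM.
rewrite ge0_integralZl_EFin//; last 2 first.
- by move=> x' _; rewrite lee_fin.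
- apply/measurable_EFinP.
  by apply: measurable_sum => e; exact: msr.
rewrite -BE; apply: (@le_trans _ _ ((2 / n%:R)%:E * (n%:R * kappa / zeta)%:E)%E).
  by apply: lee_wpmul2l; [rewrite lee_fin divr_ge0|exact: AB].
rewrite -EFinM lee_fin le_eqVlt; apply/orP; left; apply/eqP.
by field; rewrite !gt_eqF.
Qed.

End Symmetrization.

(** * The two samples *)

Section Data.
Context {R : realType} {dS} {Sp : measurableType dS} (E : experiment R Sp).
Local Notation K := (arms E).
Local Notation n := (draws E).
Local Notation nnew := (new_draws E).
Local Notation smp := (sample Sp R K n).
Local Notation cell := ('I_K * 'I_n)%type.

Definition cell_obs (ai : cell) (x : smp) : Sp * R := obs x ai.1 ai.2.
Definition of_cells (f : cell -> Sp * R) : smp :=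
  [tuple [tuple f (a, i) | i < n] | a < K].
Definition data_law := distribution (Pr E) (data E).

Definition new_obs (i : 'I_nnew) (y : nnew.-tuple Sp) : Sp := tnth y i.
Definition of_new (f : 'I_nnew -> Sp) : nnew.-tuple Sp := [tuple f i | i < nnew].
Definition new_law := distribution (Pr E) (data_new E).

Lemma data_product_sample : iid_data E ->
  product_sample cell_obs of_cells (fun ai => law ai.1) data_law.
Proof.
move=> iid; split.
- by move=> f [a i]; rewrite /cell_obs /obs !tnth_mktuple.
- move=> [a i]; rewrite /cell_obs /obs/=.
  apply: (measurableT_comp (measurable_tnth _) (measurable_tnth _)).
- move=> d' T' f mf; apply/measurable_fun_tnthP => a.
  by apply/measurable_fun_tnthP => i; exact: (mf (a, i)).
- move=> B mB; have := iid (fun a i => B (a, i)) (fun a i => mB _).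
  rewrite pair_bigA/= => Bprod.
  rewrite -[LHS]/(Pr E (data E @^-1` box cell_obs B)).
  rewrite (_ : _ @^-1` _ = [set w | forall a i, B (a, i) (obs (data E w) a i)]).
    by rewrite Bprod; apply: eq_bigr => -[].
  apply/seteqP; split=> w /= Bw; first by move=> a i; exact: (Bw (a, i)).
  by move=> [a i]; exact: Bw.
Qed.

Lemma new_product_sample : iid_new E ->
  product_sample new_obs of_new (fun=> law_new E) new_law.
Proof.
move=> iid; split.
- by move=> f i; rewrite /new_obs tnth_mktuple.
- by move=> i; exact: measurable_tnth.
- by move=> d' T' f mf; exact/measurable_fun_tnthP.
- by move=> B mB; exact: iid.
Qed.

End Data.

Arguments data_law {R dS Sp} E.
Arguments new_law {R dS Sp} E.
Arguments cell_obs {R dS Sp} E ai x.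
Arguments of_cells {R dS Sp} E f.
Arguments new_obs {R dS Sp} E i y.
Arguments of_new {R dS Sp} E f.

(** * Integration against the density of a mixture *)

Section Mixture_density.
Context {R : realType} {dX dY} {X : measurableType dX} {Y : measurableType dY}
  {I : finType} (nu : {measure set Y -> \bar R})
  (P : I -> {measure set X -> \bar R}) (phi : X -> Y) (rho : X -> R) (k : R).
Hypotheses (mphi : measurable_fun setT phi) (mrho : I -> measurable_fun setT rho)
  (rho0 : forall x, 0 <= rho x) (k0 : 0 <= k).
Hypothesis nuE : forall B, measurable B ->
  (nu B = k%:E * \sum_i \int[P i]_x (\1_B (phi x) * rho x)%:E)%E.

Import HBNNSimple.

Lemma nnsfun_integral_mixture_density (g : {nnsfun Y >-> R}) :
  (\int[nu]_y (g y)%:E =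
   k%:E * \sum_i \int[P i]_x (g (phi x) * rho x)%:E)%E.
Proof.
pose s : seq R := finmap.enum_fset (fset_set (range g)).
pose A r : set Y := g @^-1` [set r].
have mA r : measurable (A r).
  exact: (measurable_funPTI g (measurable_set1 r)).
have gE y : g y = \sum_(r <- s) `|r| * \1_(A r) y.
  rewrite fimfunE fsbig_finite//=; apply: eq_bigr => r _.
  rewrite indicE; have [|] := boolP (y \in _); last by rewrite !mulr0.
  by rewrite inE /A /= => <-; rewrite ger0_norm.
have mind r : measurable_fun setT (\1_(A r) : Y -> R) by exact: measurable_indic.
have mi (i : I) r : measurable_fun setT (fun x => \1_(A r) (phi x) * rho x).
  by apply: measurable_funM (mrho i); exact: measurableT_comp (mind r) mphi.
transitivity (\sum_(r <- s) `|r|%:E * nu (A r))%E.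
  under eq_integral do rewrite gE -sumEFin.
  rewrite ge0_integral_sum//; last first.
    by move=> r; apply/measurable_EFinP; exact: measurable_funM.
  apply: eq_bigr => r _; under eq_integral do rewrite EFinM.
  rewrite ge0_integralZl_EFin//; last exact/measurable_EFinP.
  by rewrite integral_indic// setIT.
transitivity (k%:E * \sum_i \sum_(r <- s) `|r|%:E *
    \int[P i]_x (\1_(A r) (phi x) * rho x)%:E)%E; last first.
  congr *%E; apply: eq_bigr => i _.
  under [RHS]eq_integral do rewrite gE big_distrl/= -sumEFin.
  rewrite ge0_integral_sum//; last 2 first.
  - move=> r; under eq_fun do rewrite -mulrA.
    by apply/measurable_EFinP; apply: measurable_funM => //; exact: mi.
  - by move=> r x _; rewrite lee_fin !mulr_ge0// indicE.
  apply: eq_bigr => r _; under [RHS]eq_integral do rewrite -mulrA EFinM.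
  rewrite ge0_integralZl_EFin//; last by apply/measurable_EFinP; exact: mi.
  by move=> x _; rewrite lee_fin mulr_ge0// indicE.
rewrite exchange_big/= ge0_sume_distrr; last first.
  move=> r _; apply: sume_ge0 => i _; rewrite mule_ge0//.
  by apply: integral_ge0 => x _; rewrite lee_fin mulr_ge0// indicE.
apply: eq_bigr => r _; rewrite nuE// -ge0_sume_distrr.
  by rewrite muleCA.
by move=> i _; apply: integral_ge0 => x _; rewrite lee_fin mulr_ge0// indicE.
Qed.

Lemma ge0_integral_mixture_density (f : Y -> R) :
  measurable_fun setT f -> (forall y, 0 <= f y) ->
  (\int[nu]_y (f y)%:E =
   k%:E * \sum_i \int[P i]_x (f (phi x) * rho x)%:E)%E.
Proof.
move=> mf f0; have mfE : measurable_fun setT (EFin \o f) by exact/measurable_EFinP.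
pose g := nnsfun_approx measurableT mfE.
have gf y : (g n y)%:E @[n --> \oo] --> (f y)%:E.
  by apply: (@cvg_nnsfun_approx _ _ _ _ measurableT _ mfE) => // z _; rewrite lee_fin.
have g_nd y : {homo (fun n => g n y) : m n / (m <= n)%N >-> m <= n}.
  by move=> m n mn; exact/lefP/nd_nnsfun_approx.
have cvgl : (\int[nu]_y (g n y)%:E @[n --> \oo] --> \int[nu]_y (f y)%:E)%E.
  rewrite (eq_integral (fun y => limn (fun n => (g n y)%:E))); last first.
    by move=> y _; apply/esym/cvg_lim => //; exact: gf.
  apply: cvg_monotone_convergence => //.
  - by move=> n; exact/measurable_EFinP.
  - by move=> n y _; rewrite lee_fin.
  - by move=> y _ m n mn; rewrite lee_fin; exact: g_nd.
have mgphi (i : I) n : measurable_fun setT (fun x => g n (phi x) * rho x).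
  by apply: measurable_funM (mrho i); exact: measurableT_comp.
have cvgr i : (\int[P i]_x (g n (phi x) * rho x)%:E @[n --> \oo] -->
    \int[P i]_x (f (phi x) * rho x)%:E)%E.
  rewrite (eq_integral (fun x => limn (fun n => (g n (phi x) * rho x)%:E))); last first.
    move=> x _; apply/esym/cvg_lim => //; rewrite EFinM.
    under eq_fun do rewrite EFinM.
    by apply: cvgeZr => //; exact: gf.
  apply: cvg_monotone_convergence => //.
  - by move=> n; apply/measurable_EFinP; exact: mgphi.
  - by move=> n x _; rewrite lee_fin mulr_ge0.
  - by move=> x _ m n mn; rewrite lee_fin ler_wpM2r//; exact: g_nd.
have -> : (\int[nu]_y (f y)%:E = limn (fun n => \int[nu]_y (g n y)%:E))%E.
  exact/esym/cvg_lim.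
apply/cvg_lim => //.
under eq_fun do rewrite nnsfun_integral_mixture_density.
apply: cvgeZl => //.
apply: cvg_nnesum => i _; last by have := cvgr i.
by apply: nearW => n; apply: integral_ge0 => x _; rewrite lee_fin mulr_ge0.
Qed.

End Mixture_density.

(** * The population risk *)

Lemma bounded_Lfun2 {R : realType} d (X : measurableType d) (P : probability X R)
    (f : X -> R) :
  measurable_fun setT f -> (forall x, `|f x| <= 1) -> f \in Lfun P 2%:E.
Proof.
move=> mf f1; rewrite inE; apply/andP; split; rewrite inE//=.
rewrite /finite_norm unlock; apply: poweR_lty.
apply: (@le_lt_trans _ _ (\int[P]_x (cst 1 x))%E); last first.
  by rewrite integral_cst// mul1e -ge0_fin_numE// fin_num_measure.
apply: ge0_le_integral => //.
- by move=> x _; exact: poweR_ge0.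
- apply: (measurableT_comp (measurable_poweR _)) => //.
  by apply: measurableT_comp => //; exact/measurable_EFinP.
- move=> x _ /=; rewrite lee_fin powR_mulrn//.
  by rewrite exprn_ile1.
Qed.

Section Population.
Context {R : realType} {dS} {Sp : measurableType dS} (E : experiment R Sp).
Local Notation K := (arms E).
Variable H : set (Sp -> R).
Hypothesis H_bounded : bounded_class H.

Lemma L2S_bounded (h : Sp -> R) : measurable_fun setT h -> (forall s, `|h s| <= 1) ->
  L2S E h.
Proof.
move=> mh h1 a; apply: bounded_Lfun2 => //.
exact: measurableT_comp mh measurable_fst.
Qed.

Lemma L2S_mul_integrable (a : 'I_K) h h' : L2S E h -> L2S E h' ->
  (law a).-integrable setT (EFin \o (fun z : Sp * R => h z.1 * h' z.1)).
Proof.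
by move=> Lh Lh'; apply/Lfun1_integrable; exact: (Lfun2_mul_Lfun1 (Lh a) (Lh' a)).
Qed.

Lemma Expect_ext (f g : fun_of_obs E) :
  (forall a, TK E f a = TK E g a) -> Expect E f = Expect E g.
Proof. by move=> fg; congr (meanA E _); apply/funext. Qed.

Lemma Expect_lin (f g h : fun_of_obs E) (r : R) :
  (forall a, (law a).-integrable setT (EFin \o f a)) ->
  (forall a, (law a).-integrable setT (EFin \o g a)) ->
  (forall a z, h a z = f a z + r * g a z) ->
  Expect E h = Expect E f + r * Expect E g.
Proof.
move=> fi gi hE; rewrite /Expect /meanA mulrCA -mulrDr; congr *%R.
rewrite big_distrr -big_split/=; apply: eq_bigr => a _.
rewrite /TK; under eq_Rintegral do rewrite hE.
rewrite RintegralD//; first by rewrite RintegralZl//; exact: gi.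
- exact: fi.
- exact: (integrableZl measurableT r (gi a)).
Qed.

(** The density ratio is given on events; nonnegative functions follow by
    monotone convergence, and [h] by way of the affine image [(h + 1) / 2],
    which is nonnegative. *)
Lemma theta_density rho (h : Sp -> R) : density_ratio E rho ->
  measurable_fun setT h -> (forall s, `|h s| <= 1) ->
  theta E h = Expect E (ofS E (fun s => rho s * h s)).
Proof.
move=> [Lrho rho0 rhoE] mh h1.
have int_rho (f : Sp -> R) : measurable_fun setT f -> (forall s, `|f s| <= 1) ->
    forall a : 'I_K, (law a).-integrable setT (EFin \o (fun z : Sp * R => f z.1 * rho z.1)).
  by move=> mf f1 a; exact: (L2S_mul_integrable a (L2S_bounded mf f1) Lrho).
have mrho (a : 'I_K) : measurable_fun setT (fun z : Sp * R => rho z.1).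
  by have /andP[+ _] := Lrho a; rewrite inE.
pose J (a : 'I_K) (f : Sp -> R) := \int[law a]_z (f z.1 * rho z.1).
have JE a (f : Sp -> R) : measurable_fun setT f -> (forall s, `|f s| <= 1) ->
    (\int[law a]_z (f z.1 * rho z.1)%:E = (J a f)%:E)%E.
  by move=> mf f1; rewrite fineK//; apply: integrable_fin_num => //; exact: int_rho.
have newE (f : Sp -> R) : measurable_fun setT f -> (forall s, 0 <= f s <= 1) ->
    (\int[law_new E]_s (f s)%:E = (K%:R^-1 * \sum_a J a f)%:E)%E.
  move=> mf f01; have f1 s : `|f s| <= 1.
    by have /andP[f0 f1] := f01 s; rewrite ger0_norm.
  rewrite (@ge0_integral_mixture_density _ _ _ _ _ 'I_K (law_new E) (fun a => law a) fst
    (fun z => rho z.1) K%:R^-1)//. 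
  - by rewrite EFinM -sumEFin; congr *%E; apply: eq_bigr => a _; exact: JE.
  - move=> B mB; apply: (etrans (rhoE B mB)); rewrite EFinM -sumEFin; congr *%E.
    apply: eq_bigr => a _; rewrite /TK /ofS fineK//.
    apply: integrable_fin_num => //; apply: int_rho; first exact: measurable_indic.
    by move=> s; rewrite indicE; case: (s \in B); rewrite ?normr1 ?normr0.
  - by move=> s; have /andP[] := f01 s.
pose f s := 2^-1 * (h s + 1).
have f01 s : 0 <= f s <= 1.
  by have := h1 s; rewrite ler_norml /f => /andP[? ?]; lra.
have mf : measurable_fun setT f.
  by apply: measurable_funM => //; exact: measurable_funD.
have newf : theta E f = K%:R^-1 * \sum_a J a f.
  by rewrite /theta /Rintegral newE.
have new1 : 1 = K%:R^-1 * \sum_a J a (cst 1).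
  rewrite -[RHS]/(fine (_%:E)) -newE//; last by move=> s /=; rewrite ler01 lexx.
  rewrite (eq_integral (cst 1%E))// integral_cst// mul1e.
  by rewrite [X in fine X](_ : _ = 1%E)//; exact: probability_setT.
have f1 s : `|f s| <= 1 by have /andP[? ?] := f01 s; rewrite ger0_norm.
have hE s : h s = 2 * f s - cst 1 s by rewrite /f /=; field.
have -> : theta E h = 2 * theta E f - 1.
  rewrite /theta; under eq_Rintegral do rewrite hE.
  have fi : (law_new E).-integrable setT (EFin \o f).
    exact: bounded_integrable mf f1.
  have ci : (law_new E).-integrable setT (EFin \o (cst 1 : Sp -> R)).
    by apply: (@bounded_integrable _ _ _ _ _ 1) => // s; rewrite normr1.
  rewrite RintegralB//; last first.
    exact: (integrableZl measurableT 2 fi).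
  rewrite RintegralZl// Rintegral_cst// mul1r.
  by rewrite [X in fine X](_ : _ = 1%E)//; exact: probability_setT.
rewrite newf [X in _ - X]new1 mulrCA -mulrBr /Expect /meanA; congr *%R.
rewrite big_distrr -sumrB; apply: eq_bigr => a _ /=.
rewrite /TK /J -RintegralZl//; last exact: int_rho.
rewrite -RintegralB//; last 2 first.
- exact: (integrableZl measurableT 2 (int_rho _ mf f1 a)).
- by apply: int_rho => // s; rewrite normr1.
by apply: eq_Rintegral => z _; rewrite /ofS hE/=; ring.
Qed.

Lemma sub_closed_span : H `<=` closed_span E H.
Proof.
move=> h Hh; have [mh h1] := H_bounded Hh; split; first exact: L2S_bounded.
move=> eps eps0; exists h.
  exists 1%N, (fun=> 1), (fun=> h); split=> //.
  by apply/funext => s; rewrite big_ord1 mul1r.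
rewrite (_ : norm_obs _ _ = 0)//.
rewrite /norm_obs /meanA big1 ?mulr0 ?sqrtr0// => a _.
rewrite /norm_arm (_ : \int[_]_z _ = 0) ?sqrtr0 ?expr0n//.
by rewrite /Rintegral integral0_eq// => z _; rewrite /ofS subrr expr0n.
Qed.

(** [theta h = E[rho h] = E[alpha h] = E[(Tstar (TK xi0)) h]], and the adjoint
    moves [Tstar] to the other side. *)
Lemma theta_inner rho alpha Tstar xi0 h :
  density_ratio E rho ->
  is_projection E (closed_span E H) rho alpha ->
  is_adjoint E (closed_span E H) Tstar ->
  Xi E H Tstar alpha xi0 -> H h ->
  theta E h = meanA E (fun a => TK E (ofS E xi0) a * TK E (ofS E h) a).
Proof.
move=> drho [Valpha proj] adj [Hxi0 eqT] Hh.
have [mh h1] := H_bounded Hh; have Vh := sub_closed_span Hh.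
have Lh := L2S_bounded mh h1.
have [Lrho _ _] := drho; have [Lalpha _] := Valpha.
have [[LT _] <-//] := adj (TK E (ofS E xi0)).
rewrite (theta_density drho)//.
have := proj h Vh.
rewrite (@Expect_lin (ofS E (fun s => rho s * h s)) (ofS E (fun s => alpha s * h s))
  _ (-1)); last 3 first.
- by move=> a; exact: L2S_mul_integrable.
- by move=> a; exact: L2S_mul_integrable.
- by move=> a z; rewrite /ofS; ring.
rewrite mulN1r => /eqP; rewrite subr_eq0 => /eqP ->.
apply: Expect_ext => a; rewrite /TK /Rintegral; congr fine.
apply: ae_eq_integral => //.
- exact: measurable_int (L2S_mul_integrable a Lalpha Lh).
- exact: measurable_int (L2S_mul_integrable a LT Lh).
- by apply: filterS (eqT a) => z Tz _ /=; rewrite /ofS Tz.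
Qed.

End Population.

(** * From critical radii to global bounds *)

Section Complexities.
Context {R : realType} {dS} {Sp : measurableType dS} (E : experiment R Sp).
Local Notation K := (arms E).
Local Notation n := (draws E).
Local Notation N := (nobs E).
Local Notation smp := (sample Sp R K n).
Local Notation cell := ('I_K * 'I_n)%type.
Hypothesis N0 : (0 < N)%N.

Definition on_fold (v : bool) : pred cell := fun ai => fold ai.1 ai.2 == v.

Definition bounded_obs (b : R) (F : set (fun_of_obs E)) : Prop :=
  forall f, F f -> forall a,
    measurable_fun setT (f a) /\ forall z, `|f a z| <= b.

Lemma norm_obs_le (f : fun_of_obs E) (b : R) : 0 <= b ->
  (forall a, measurable_fun setT (f a) /\ forall z, `|f a z| <= b) ->
  norm_obs E f <= b.
Proof.
move=> b0 fb; have -> : b = Num.sqrt (b ^+ 2) by rewrite sqrtr_sqr ger0_norm.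
rewrite ler_sqrt ?sqr_ge0//.
have arm_le a : norm_arm E a f ^+ 2 <= b ^+ 2.
  have [mf fa] := fb a.
  have f2 z : f a z ^+ 2 <= b ^+ 2 by rewrite -[leLHS]real_normK ?num_real// lerXn2r ?nnegrE.
  rewrite /norm_arm sqr_sqrtr; last by apply: Rintegral_ge0 => z _; exact: sqr_ge0.
  apply: (@le_trans _ _ (\int[law a]_z (cst (b ^+ 2) z))).
    apply: le_Rintegral => //.
    - apply: (@bounded_integrable _ _ _ _ _ (b ^+ 2)); first exact: measurable_funX.
      by move=> z; rewrite ger0_norm ?sqr_ge0.
    - by apply: (@bounded_integrable _ _ _ _ _ (b ^+ 2)) => // z; rewrite ger0_norm ?sqr_ge0.
  rewrite Rintegral_cst// [X in fine X](_ : _ = 1%E) ?mulr1//.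
  exact: probability_setT.
rewrite /meanA; case: (posnP K) => [K0|K0].
  by rewrite [X in X%:R]K0 invr0 mul0r sqr_ge0.
rewrite ler_pdivrMl ?ltr0n// (le_trans (ler_sum _ (fun a _ => arm_le a)))//.
by rewrite sumr_const card_ord mulr_natl.
Qed.

Lemma cell_sum v (u : cell -> R) :
  \sum_(a < K) \sum_(i < n | fold a i == v) u (a, i) = \sum_(ai | on_fold v ai) u ai.
Proof. by rewrite pair_big_dep/=; apply: eq_big => -[]. Qed.

Lemma rad_sup_foldE v F delta e x : rad_sup_fold E v F delta e x =
  sup [set 2 / N%:R * \sum_(ai | on_fold v ai) rad e ai * f ai.1 (cell_obs E ai x)
      | f in F `&` [set f | norm_obs E f <= delta]].
Proof.
congr sup; apply: eq_imagel => f _; congr *%R.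
by rewrite -(cell_sum v (fun ai => rad e ai * f ai.1 (cell_obs E ai x))).
Qed.

Lemma star_bounded F b : 0 <= b -> bounded_obs b F -> bounded_obs b (star E F).
Proof.
move=> b0 Fb _ [g [f [g0 g1 /Fb fb ->]]] a; have [mf fa] := fb a; split.
  exact: measurable_funM.
move=> z; rewrite normrM ger0_norm//.
by rewrite (le_trans (ler_wpM2r _ g1))// mul1r.
Qed.

Lemma rad_sup_fold_ub v F delta b e x : bounded_obs b F ->
  has_ubound [set 2 / N%:R * \sum_(ai | on_fold v ai)
      rad e ai * f ai.1 (cell_obs E ai x)
    | f in F `&` [set f | norm_obs E f <= delta]].
Proof.
move=> Fb; exists (2 / N%:R * \sum_(ai : cell | on_fold v ai) b) => _ [f [/Fb fb _] <-].
rewrite ler_wpM2l// ler_sum// => ai _.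
rewrite (le_trans (ler_norm _))// normrM /rad normr_sign mul1r.
by have [_] := fb ai.1; exact.
Qed.

(** The factor [delta / b] brings [f] into the star hull and into the ball of
    radius [delta] at the same time: this exchanges the localized complexity
    for a global one, at the price of a factor [b / delta]. *)
Lemma star_rad_sup v F delta b e x f : 0 < delta -> delta <= 1 -> 1 <= b ->
  bounded_obs b F -> F f ->
  delta / b * (2 / N%:R * \sum_(ai | on_fold v ai) rad e ai * f ai.1 (cell_obs E ai x))
    <= rad_sup_fold E v (star E F) delta e x.
Proof.
move=> d0 d1 b1 Fb Ff; have b0 : 0 < b := lt_le_trans ltr01 b1.
rewrite rad_sup_foldE; apply: ub_le_sup.
  exact: rad_sup_fold_ub (star_bounded (ltW b0) Fb).
exists (fun a z => delta / b * f a z).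
  split.
    exists (delta / b), f; split=> //; first by rewrite divr_ge0// ltW.
    by rewrite ler_pdivrMr// mul1r (le_trans d1).
  apply: norm_obs_le; first exact: ltW.
  move=> a; have [mf fb] := Fb f Ff a; split; first exact: measurable_funM.
  move=> z; rewrite normrM ger0_norm; last by rewrite divr_ge0// ltW.
  by rewrite mulrAC ler_pdivrMr// ler_wpM2l// ltW.
rewrite [RHS]mulrCA; congr *%R; rewrite [RHS]big_distrr; apply: eq_bigr => ai _ /=.
by rewrite mulrCA.
Qed.

(** The star hull contains 0, of norm 0. *)
Lemma rad_sup_fold_ge0 v F delta b e x : 0 <= delta -> 0 <= b ->
  bounded_obs b F -> F !=set0 -> 0 <= rad_sup_fold E v (star E F) delta e x.
Proof.
move=> d0 b0 Fb [f Ff]; rewrite rad_sup_foldE; apply: ub_le_sup.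
  exact: rad_sup_fold_ub (star_bounded b0 Fb).
exists (fun a z => 0 * f a z).
  split; first by exists 0, f; split.
  apply: norm_obs_le => // a; split.
    by under eq_fun do rewrite mul0r; exact: measurable_cst.
  by move=> z; rewrite mul0r normr0.
by rewrite big1 ?mulr0// => ai _; rewrite mul0r mulr0.
Qed.

(** Measured in units of a radius that may depend on the sample, a class has a
    Rademacher bound that is a constant, so that conditional and unconditional
    radii are treated alike. Beyond radius 1 the class is emptied: the theorem
    is then trivial, since the target norm is at most 2. *)
Definition scaled (F : smp -> set (fun_of_obs E)) (delta : smp -> R) (x : smp) :
    set (cell -> Sp * R -> R) :=
  [set g | delta x <= 1 /\
     exists2 f, F x f & g = fun ai z => f ai.1 z / delta x].

(** Two factors [1 / delta x], one from [star_rad_sup] and one from the unit of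
    [scaled], meet the bound [delta x ^ 2] on the complexity. The bound 2 in the
    hypothesis leaves room for an infimum over majorants that is not reached. *)
Lemma rad_controlled_of_majorant v (F : smp -> set (fun_of_obs E))
    (delta : smp -> R) b U :
  1 <= b -> (forall x, F x !=set0) -> (forall x, bounded_obs b (F x)) ->
  (forall x, 0 < delta x) -> measurable_fun setT delta ->
  majorant (data E)
    (fun e x => rad_sup_fold E v (star E (F x)) (delta x) e x) U ->
  (\int[data_law E]_x (\sum_e U e x / delta x ^+ 2)%:E <=
     (#|{: {ffun cell -> bool}}|%:R * 2)%:E)%E ->
  rad_controlled (cell_obs E) (data_law E) (on_fold v) (scaled F delta)
    (2 * N%:R * b).
Proof.
move=> b1 F0 Fb d0 md Umaj Uint; have b0 : 0 < b := lt_le_trans ltr01 b1.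
have mU e : measurable_fun setT (U e) by have [] := Umaj e.
have UF e x : rad_sup_fold E v (star E (F x)) (delta x) e x <= U e x.
  by have [_ _] := Umaj e; exact.
have U0 e x : 0 <= U e x.
  by apply: le_trans (UF e x); apply: rad_sup_fold_ge0 (ltW b0) (Fb x) (F0 x); exact: ltW.
have N0' : 0 < N%:R :> R by rewrite ltr0n.
have mdV : measurable_fun setT (fun x => (delta x ^+ 2)^-1).
  under eq_fun do rewrite -powR_inv1 ?sqr_ge0//.
  by apply: (measurableT_comp (measurable_powR _)) => //; exact: measurable_funX.
pose w x : R := N%:R / 2 * (b / delta x ^+ 2).
have w0 x : 0 <= w x.
  by apply: mulr_ge0; apply: divr_ge0; rewrite ?exprn_ge0// ltW.
exists (fun e x => w x * (U e x + U (opp_signs e) x)); split.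
- move=> e; apply: measurable_funM; last exact: measurable_funD.
  by apply: measurable_funM => //; exact: measurable_funM.
- by move=> e x; rewrite mulr_ge0// addr_ge0.
- move=> x _ e [d1 [f Ff ->]].
  have le_w s : \sum_(ai | on_fold v ai) rad s ai * (f ai.1 (cell_obs E ai x) / delta x)
      <= w x * U s x.
    have := le_trans (star_rad_sup v s x (d0 x) d1 b1 (Fb x) Ff) (UF s x).
    set A := \sum_(ai | _) _ => AU.
    rewrite (_ : \sum_(ai | _) _ = w x * (delta x / b * (2 / N%:R * A))).
      exact: ler_wpM2l.
    rewrite /A /w; under eq_bigr do rewrite mulrA.
    rewrite -big_distrl/=; field.
    by rewrite !gt_eqF.
  rewrite mulrDr ler_norml; apply/andP; split; last first.
    by rewrite (le_trans (le_w e))// lerDl mulr_ge0.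
  rewrite lerNl -sumrN.
  under eq_bigr do rewrite -mulNr -rad_opp.
  by rewrite (le_trans (le_w (opp_signs e)))// lerDr mulr_ge0.
- have -> : (fun x => (\sum_e w x * (U e x + U (opp_signs e) x))%:E) =
      fun x => ((N%:R * b)%:E * (\sum_e U e x / delta x ^+ 2)%:E)%E.
    apply/funext => x; rewrite -EFinM; congr EFin.
    rewrite -!big_distrl -big_distrr big_split/= (sum_opp (U ^~ x)) /w; field.
    by rewrite gt_eqF.
  rewrite ge0_integralZl_EFin//; last 3 first.
  + move=> x _; rewrite lee_fin sumr_ge0// => e _; rewrite divr_ge0// exprn_ge0//.
    exact: ltW.
  + apply/measurable_EFinP; apply: measurable_sum => e; exact: measurable_funM.
  + by rewrite mulr_ge0// ltW.
  apply: (le_trans (lee_wpmul2l _ Uint)); first by rewrite lee_fin mulr_ge0// ltW.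
  by rewrite -EFinM lee_fin le_eqVlt; apply/orP; left; apply/eqP; ring.
Qed.

End Complexities.

Arguments on_fold {R dS Sp} E v.

Lemma majorant_integral {R : realType} d (Om : measurableType d)
    (P : probability Om R) d' (T : measurableType d') (X : {RV P >-> T})
    (I : finType) (F U : {ffun I -> bool} -> T -> R) :
  majorant X F U ->
  (\int[distribution P X]_x (\sum_e U e x)%:E =
   (#|{: {ffun I -> bool}}|%:R * sign_mean (fun e => \int[P]_w U e (X w)))%:E)%E.
Proof.
move=> Umaj.
have mU e : measurable_fun setT (U e) by have [] := Umaj e.
have iU e : P.-integrable setT (EFin \o (U e \o X)) by have [] := Umaj e.
have n0 : #|{: {ffun I -> bool}}|%:R != 0 :> R.
  by rewrite pnatr_eq0 -lt0n; apply/card_gt0P; exists [ffun=> true].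
have sumE : (fun w => (\sum_e U e (X w))%:E) = (fun w => \sum_e (EFin \o (U e \o X)) w)%E.
  by apply/funext => w; rewrite -sumEFin.
rewrite integral_distribution.
- rewrite /comp sumE integral_sum// /sign_mean mulrA divff// mul1r -sumEFin.
  by apply: eq_bigr => e _; rewrite /Rintegral fineK//; exact: (integrable_fin_num measurableT (iU e)).
- by apply/measurable_EFinP; exact: measurable_sum.
- by rewrite /comp sumE; exact: integrable_sum.
Qed.

Section Critical_radii.
Context {R : realType} {dS} {Sp : measurableType dS} (E : experiment R Sp).
Local Notation K := (arms E).
Local Notation n := (draws E).
Local Notation N := (nobs E).
Local Notation smp := (sample Sp R K n).
Local Notation cell := ('I_K * 'I_n)%type.
Hypotheses (N0 : (0 < N)%N) (iid : iid_data E).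

Let S := data_product_sample iid.

Lemma rad_controlled_solves (F : set (fun_of_obs E)) delta b :
  1 <= b -> F !=set0 -> bounded_obs b F -> solves E F delta ->
  rad_controlled (cell_obs E) (data_law E) (on_fold E false)
    (scaled (fun=> F) (fun=> delta)) (2 * N%:R * b).
Proof.
move=> b1 F0 Fb [d0 dF].
have /ereal_inf_lt[_ [U Umaj <-]] :
    (complexity E (star E F) delta < (2 * delta ^+ 2)%:E)%E.
  by rewrite (le_lt_trans dF)// lte_fin mulr_natl mulr2n ltrDl exprn_gt0.
rewrite lte_fin => Ud.
have U0 e x : 0 <= U e x.
  have [_ _ /(_ x)] := Umaj e; apply: le_trans.
  by apply: rad_sup_fold_ge0 Fb F0; [exact: ltW|exact: le_trans b1].
apply: (rad_controlled_of_majorant _ b1 _ _ _ _ Umaj) => //.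
have mU e : measurable_fun setT (U e) by have [] := Umaj e.
rewrite (_ : (fun x => (\sum_e U e x / delta ^+ 2)%:E) =
    fun x => ((delta ^+ 2)^-1%:E * (\sum_e U e x)%:E)%E); last first.
  by apply/funext => x; rewrite -EFinM -big_distrl mulrC.
rewrite ge0_integralZl_EFin//; last 3 first.
- by move=> x _; rewrite lee_fin sumr_ge0.
- by apply/measurable_EFinP; exact: measurable_sum.
- by rewrite invr_ge0 sqr_ge0.
rewrite (majorant_integral Umaj) -EFinM lee_fin mulrCA ler_wpM2l//.
by rewrite ler_pdivrMl ?exprn_gt0// mulrC ltW.
Qed.

(** The radius is a function of [D_0] and so is constant when the other fold is
    redrawn. Splicing along the folds then writes the integral of [U e / delta
    ^ 2] as the mean over [D_0] of the conditional complexity divided by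
    [delta ^ 2], which is at most 1. *)
Lemma rad_controlled_solves_cond0 (F : smp -> set (fun_of_obs E)) delta b :
  1 <= b -> (forall x, F x !=set0) -> (forall x, bounded_obs b (F x)) ->
  solves_cond0 E F delta ->
  rad_controlled (cell_obs E) (data_law E) (on_fold E true)
    (scaled F delta) (2 * N%:R * b).
Proof.
move=> b1 F0 Fb [[md dD0] d0 [U Umaj Ucond]].
have U0 e x : 0 <= U e x.
  have [_ _ /(_ x)] := Umaj e; apply: le_trans.
  by apply: rad_sup_fold_ge0 (Fb x) (F0 x); [exact: ltW|exact: le_trans b1].
apply: (rad_controlled_of_majorant _ b1 _ _ _ _ Umaj) => //.
pose k : R := #|{: {ffun cell -> bool}}|%:R.
have k0 : 0 < k by rewrite ltr0n; apply/card_gt0P; exists [ffun=> true].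
have mU e : measurable_fun setT (U e) by have [] := Umaj e.
have mdV : measurable_fun setT (fun x => (delta x ^+ 2)^-1).
  under eq_fun do rewrite -powR_inv1 ?sqr_ge0//.
  by apply: (measurableT_comp (measurable_powR _)) => //; exact: measurable_funX.
pose m (ai : cell) := fold ai.1 ai.2.
pose g x := (\sum_e U e x / delta x ^+ 2)%:E.
have mg : measurable_fun setT g.
  by apply/measurable_EFinP; apply: measurable_sum => e; exact: measurable_funM.
have g0 x : (0 <= g x)%E.
  by rewrite lee_fin sumr_ge0// => e _; rewrite divr_ge0// sqr_ge0.
have mgs : measurable_fun setT (fun z =>
    \int[data_law E]_x' g (splice (cell_obs E) (of_cells E) m z x'))%E.
  have := @measurable_fun_fubini_tonelli_F _ _ _ _ R (data_law E) _
    (measurableT_comp mg (measurable_splice S m)).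
  by apply => z; exact: g0.
rewrite -(splice_law S m mg g0) ge0_integral_distribution; last 2 first.
- exact: mgs.
- by move=> x; exact: integral_ge0.
apply: (@le_trans _ _ (\int[Pr E]_w (cst k%:E w))%E); last first.
  rewrite integral_cst// [X in (_ * X)%E](_ : _ = 1%E); last exact: probability_setT.
  by rewrite mule1 lee_fin -/k; lra.
apply: ae_ge0_le_integral => //.
- by move=> w _; exact: integral_ge0.
- exact: (measurableT_comp mgs).
- by move=> w _; rewrite lee_fin ltW.
apply: filterS Ucond => w Uw _ /=.
set z := data E w.
have dz x' : delta (splice (cell_obs E) (of_cells E) m z x') = delta z.
  apply/esym/dD0 => a i ai; rewrite -[RHS]/(cell_obs E (a, i) _) (c_splice S) /m/= ai.
  by [].
pose J e := (\int[Pr E]_w' (U e (join_folds E z (data E w')))%:E)%E.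
have JE : (\int[data_law E]_x' g (splice (cell_obs E) (of_cells E) m z x') =
    (delta z ^+ 2)^-1%:E * \sum_e J e)%E.
  have mj : measurable_fun setT (join_folds E z).
    apply: measurableT_comp (measurable_splice S m) (measurable_pair1 z).
  have mUj e : measurable_fun setT (fun x' => (U e (join_folds E z x'))%:E).
    by apply/measurable_EFinP; exact: measurableT_comp.
  transitivity (\int[data_law E]_x' ((delta z ^+ 2)^-1%:E *
      \sum_e (U e (join_folds E z x'))%:E))%E.
    apply: eq_integral => x' _; rewrite /g dz sumEFin -EFinM; congr EFin.
    by rewrite -big_distrl mulrC.
  rewrite ge0_integralZl_EFin//; last 3 first.
  - by move=> x' _; apply: sume_ge0 => e _; rewrite lee_fin.
  - exact: emeasurable_sum.
  - by rewrite invr_ge0 sqr_ge0.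
  congr *%E; rewrite ge0_integral_sum//; last by move=> e x' _; rewrite lee_fin.
  apply: eq_bigr => e _; rewrite ge0_integral_distribution// => x'.
  by rewrite lee_fin.
rewrite JE lee_pdivrMl ?exprn_gt0// muleC.
by move: Uw; rewrite -/z -/k lee_pdivrMl.
Qed.

End Critical_radii.

(** * Fluctuations over one fold *)

Lemma balanced_involution (T : finType) (f : T -> bool) :
  #|[pred i | f i == true]| = #|[pred i | f i == false]| ->
  exists2 s : T -> T, involutive s & forall i, f (s i) = ~~ f i.
Proof.
pose en (b : bool) := enum [pred i | f i == b] => /=.
rewrite !cardE -/(en true) -/(en false) => en_size.
have size_en b : size (en b) = size (en (~~ b)) by case: b.
have mem_en b i : (i \in en b) = (f i == b) by rewrite mem_enum inE.
have uniq_en b : uniq (en b) by exact: enum_uniq.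
pose s i := nth i (en (~~ f i)) (index i (en (f i))).
have index_lt i : (index i (en (f i)) < size (en (~~ f i)))%N.
  by rewrite -size_en index_mem mem_en.
have fs i : f (s i) = ~~ f i.
  have : s i \in en (~~ f i) by rewrite mem_nth.
  by rewrite mem_en => /eqP.
exists s => // i; rewrite {1}/s fs negbK {2}/s index_uniq//.
by rewrite (set_nth_default i) ?nth_index// ?mem_en// size_en.
Qed.

Section Events.
Context {R : realType} {dS} {Sp : measurableType dS} (E : experiment R Sp).
Local Notation K := (arms E).
Local Notation n := (draws E).
Local Notation N := (nobs E).
Local Notation smp := (sample Sp R K n).
Local Notation cell := ('I_K * 'I_n)%type.
Hypotheses (spl : split_sampling E) (iid : iid_data E).

Let S := data_product_sample iid.

Lemma fold_swap : exists s : cell -> cell,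
  [/\ involutive s, forall ai, (s ai).1 = ai.1 &
      forall ai v, on_fold E v (s ai) = on_fold E (~~ v) ai].
Proof.
have [_ _ _ half] := spl.
have /choice[s sP] (a : 'I_K) : exists s : 'I_n -> 'I_n,
    involutive s /\ forall i, fold a (s i) = ~~ fold a i.
  by have [|s sK sf] := @balanced_involution 'I_n (fold a); [rewrite !half|exists s].
exists (fun ai => (ai.1, s ai.1 ai.2)); split=> [[a i]|//|[a i] v] /=.
  by have [sK _] := sP a; rewrite sK.
rewrite /on_fold/=; have [_ ->] := sP a.
by case: (fold a i) v => -[].
Qed.

Lemma rad_controlled_fold v (F : set (fun_of_obs E)) delta kappa :
  rad_controlled (cell_obs E) (data_law E) (on_fold E false)
    (scaled (fun=> F) (fun=> delta)) kappa ->
  rad_controlled (cell_obs E) (data_law E) (on_fold E v)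
    (scaled (fun=> F) (fun=> delta)) kappa.
Proof.
case: v => //; have [s [sK s1 sf]] := fold_swap.
apply: (rad_relabel S sK) => [ai|ai|x _ [d1 [f Ff ->]]].
- by rewrite s1.
- by rewrite sf.
- exists (fun ai z => f ai.1 z / delta); first by split=> //; exists f.
  by move=> ai _; rewrite s1.
Qed.

(** The weights and the class may depend on the sample, but only through the
    coordinates outside the fold [v]. *)
Lemma scaled_event v (F : smp -> set (fun_of_obs E)) (delta : smp -> R) b kappa
    zeta (W : smp -> cell -> Sp * R -> R) :
  0 < kappa -> 0 < zeta -> (forall x, 0 < delta x) ->
  (forall x, bounded_obs b (F x)) ->
  rad_controlled (cell_obs E) (data_law E) (on_fold E v) (scaled F delta) kappa ->
  (forall ai, measurable_fun setT (fun x => W x ai (cell_obs E ai x))) ->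
  (forall x ai, measurable_fun setT (W x ai)) ->
  (forall x ai z, `|W x ai z| <= 1) ->
  (forall x x' (m : cell -> bool), (forall ai, m ai -> on_fold E v ai) ->
     let y := splice (cell_obs E) (of_cells E) m x x' in
     [/\ F y = F x, delta y = delta x & W y = W x]) ->
  exists A, [/\ measurable A, ((1 - zeta)%:E <= data_law E A)%E &
    forall x f, A x -> F x f -> delta x <= 1 ->
      `|\sum_(ai | on_fold E v ai) (W x ai (cell_obs E ai x) * f ai.1 (cell_obs E ai x)
          - \int[law ai.1]_z (W x ai z * f ai.1 z))| <= 2 * kappa / zeta * delta x].
Proof.
move=> k0 z0 d0 Fb ctrl mWx mW W1 inv.
pose F' x : set (cell -> Sp * R -> R) := [set g | exists2 f, scaled F delta x f &
  g = fun ai z => W x ai z * f ai z].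
have Wf x f ai : F x f -> measurable_fun setT (fun z => W x ai z * f ai.1 z) /\
    forall z, `|W x ai z * f ai.1 z| <= b.
  move=> Ff; have [mf fb] := Fb x f Ff ai.1; split; first exact: measurable_funM.
  by move=> z; rewrite normrM (le_trans (ler_wpM2r _ (W1 x ai z)))// mul1r.
have [|||A [mA PA AP]] := symmetrization S (D := on_fold E v) (F := F') k0 z0.
- move=> x _ ai [_ [_ [f Ff ->]] ->].
  have [mg gb] := Wf x f ai Ff; split.
    by under eq_fun do rewrite mulrA; exact: measurable_funM.
  exists (b * `|(delta x)^-1|) => z.
  by rewrite mulrA normrM ler_wpM2r.
- move=> x x' m g mD [f Ff ->]; have [FE dE WE] := inv x x' m mD.
  by exists f; [rewrite /scaled/= FE dE|rewrite WE].
- apply: (rad_contraction (w := fun x ai => W x ai (cell_obs E ai x)) _ _ _ ctrl) => //.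
  by move=> x g [f Ff ->]; exists f.
exists A; split=> // x f Ax Ff d1.
have le1 := AP x (fun ai z => W x ai z * (f ai.1 z / delta x)) Ax
  (ex_intro2 _ _ (fun ai z => f ai.1 z / delta x)
    (conj d1 (ex_intro2 _ _ f Ff erefl)) erefl).
rewrite -ler_pdivrMr ?d0//; apply: le_trans le1.
rewrite -[X in _ / X](ger0_norm (ltW (d0 x))).
rewrite -normfV -normrM big_distrl/= le_eqVlt; apply/orP; left; apply/eqP.
congr `| _ |; apply: eq_bigr => ai _.
have [mg gb] := Wf x f ai Ff.
rewrite mulrBl mulrA; congr (_ - _).
rewrite -RintegralZr//; last exact: bounded_integrable mg gb.
by apply: eq_Rintegral => z _; rewrite mulrA.
Qed.

End Events.

(** * Fluctuations over the new sample *)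

Section New_sample.
Context {R : realType} {dS} {Sp : measurableType dS} (E : experiment R Sp).
Local Notation nnew := (new_draws E).
Variable H : set (Sp -> R).
Hypotheses (H_bounded : bounded_class H) (nnew_gt0 : (0 < nnew)%N)
  (iid : iid_new E).

Let S := new_product_sample iid.

Lemma norm_new_le1 h : H h -> norm_new E h <= 1.
Proof.
move=> Hh; have [mh h1] := H_bounded Hh.
rewrite -[leRHS]sqrtr1 ler_sqrt ?ler01//.
have h2 s : h s ^+ 2 <= 1 by rewrite -[leLHS]real_normK ?num_real// exprn_ile1.
apply: (@le_trans _ _ (\int[law_new E]_s (cst 1 s))).
  apply: le_Rintegral => //.
  - apply: (@bounded_integrable _ _ _ _ _ 1); first exact: measurable_funX.
    by move=> z; rewrite ger0_norm ?sqr_ge0.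
  - by apply: (@bounded_integrable _ _ _ _ _ 1) => // z; rewrite normr1.
rewrite Rintegral_cst// [X in fine X](_ : _ = 1%E) ?mulr1//.
exact: probability_setT.
Qed.

Lemma rad_sup_new_ge h e y : H h ->
  nnew%:R^-1 * \sum_(i < nnew) rad e i * h (tnth y i) <= rad_sup_new E H 1 e y.
Proof.
move=> Hh; apply: ub_le_sup; last by exists h => //; split=> //; exact: norm_new_le1.
exists (nnew%:R^-1 * \sum_(i < nnew) 1) => _ [h' [/H_bounded[_ h1] _] <-].
rewrite ler_wpM2l// ler_sum// => i _.
by rewrite (le_trans (ler_norm _))// normrM /rad normr_sign mul1r.
Qed.

(** The class need not contain 0, so its Rademacher suprema can be negative,
    whereas the majorants of [rad_controlled] are nonnegative. Subtracting the
    Rademacher sum of [h0] makes the suprema nonnegative; that sum changes sign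
    with [e], so the mean over the signs stays the same. *)
Lemma rad_controlled_new h0 r : H h0 -> (complexity_new E H 1 < r%:E)%E ->
  rad_controlled (new_obs E) (new_law E) predT
    (fun=> [set g | exists2 h, H h & g = fun=> (fun s => h s - h0 s)])
    (2 * nnew%:R * r).
Proof.
move=> Hh0 /ereal_inf_lt[_ [U Umaj <-]]; rewrite lte_fin => Ur.
have [mh0 h01] := H_bounded Hh0.
have mU e : measurable_fun setT (U e) by have [] := Umaj e.
have UH h e y : H h -> nnew%:R^-1 * \sum_(i < nnew) rad e i * h (tnth y i) <= U e y.
  by move=> Hh; apply: le_trans (rad_sup_new_ge e y Hh) _; have [_ _] := Umaj e; exact.
have N0 : 0 < nnew%:R :> R by rewrite ltr0n.
pose A0 e y : R := nnew%:R^-1 * \sum_(i < nnew) rad e i * h0 (tnth y i).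
have A0neg e y : A0 (opp_signs e) y = - A0 e y.
  by rewrite /A0 -mulrN -sumrN; congr *%R; apply: eq_bigr => i _; rewrite rad_opp mulNr.
pose V e y := nnew%:R * (U e y - A0 e y).
have V0 e y : 0 <= V e y by rewrite mulr_ge0 ?subr_ge0// UH.
have mA0 e : measurable_fun setT (A0 e).
  apply: measurable_funM => //; apply: measurable_sum => i.
  apply: measurable_funM => //.
  exact: (measurableT_comp mh0 (measurable_tnth i)).
exists (fun e y => V e y + V (opp_signs e) y); split.
- by move=> e; apply: measurable_funD; apply: measurable_funM => //; exact: measurable_funB.
- by move=> e y; rewrite addr_ge0.
- move=> y _ e [h Hh ->].
  have le_V s : \sum_(i | predT i) rad s i * (h (new_obs E i y) - h0 (new_obs E i y))
      <= V s y.
    rewrite /V -ler_pdivrMl// lerBrDr /A0 -mulrDr -big_split/=.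
    under eq_bigr do rewrite -mulrDr subrK.
    exact: UH.
  rewrite ler_norml; apply/andP; split; last by rewrite (le_trans (le_V e))// lerDl.
  rewrite lerNl -sumrN; under eq_bigr do rewrite -mulNr -rad_opp.
  by rewrite (le_trans (le_V (opp_signs e)))// lerDr.
- rewrite (eq_integral (fun y => (2 * nnew%:R)%:E * (\sum_e U e y)%:E)%E); last first.
    move=> y _; rewrite -EFinM; congr EFin.
    under eq_bigr do rewrite /V A0neg.
    under eq_bigr do rewrite -mulrDr addrACA opprK addNr addr0.
    by rewrite -big_distrr big_split/= (sum_opp (U ^~ y)); ring.
  rewrite integralZl//; last first.
    rewrite (_ : (fun y => _) = fun y => (\sum_e (EFin \o U e) y)%E); last first.
      by apply/funext => y; rewrite sumEFin.
    apply: integrable_sum => // e _; apply: integrable_pushforward => //.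
      exact/measurable_EFinP.
    by rewrite preimage_setT; have [] := Umaj e.
  rewrite (majorant_integral Umaj) -EFinM lee_fin mulrCA.
  by rewrite ler_wpM2l// ler_wpM2l ?mulr_ge0// ltW.
Qed.

Lemma new_event h0 r zeta : H h0 -> (complexity_new E H 1 < r%:E)%E ->
  0 < r -> 0 < zeta ->
  exists A, [/\ measurable A, ((1 - zeta)%:E <= new_law E A)%E &
    forall y h, A y -> H h ->
      `|nnew%:R^-1 * (\sum_(i < nnew) (h (tnth y i) - h0 (tnth y i)))
        - (theta E h - theta E h0)| <= 4 * r / zeta].
Proof.
move=> Hh0 hr r0 z0; have [mh0 h01] := H_bounded Hh0.
have N0 : 0 < nnew%:R :> R by rewrite ltr0n.
have k0 : 0 < 2 * nnew%:R * r by rewrite !mulr_gt0.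
have [||A [mA PA AP]] := symmetrization S k0 z0 _ _ (rad_controlled_new Hh0 hr).
  move=> _ _ i [h /H_bounded[mh h1] ->]; split; first exact: measurable_funB.
  by exists 2 => s; rewrite (le_trans (ler_normB _ _))// -[2]/(1 + 1) lerD.
  by [].
exists A; split=> // y h Ay Hh; have [mh h1] := H_bounded Hh.
have := AP y _ Ay (ex_intro2 _ _ h Hh erefl).
have -> : \sum_(i | predT i) (h (new_obs E i y) - h0 (new_obs E i y) -
    \int[law_new E]_z (h z - h0 z)) = nnew%:R *
    (nnew%:R^-1 * (\sum_(i < nnew) (h (tnth y i) - h0 (tnth y i)))
        - (theta E h - theta E h0)).
  rewrite mulrBr mulrA divff ?gt_eqF// mul1r sumrB; congr (_ - _).
  rewrite sumr_const card_ord -[LHS]mulr_natl; congr *%R.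
  by rewrite /theta RintegralB//; apply: bounded_integrable; eassumption.
rewrite normrM gtr0_norm// -ler_pdivlMl// => /le_trans; apply.
rewrite le_eqVlt; apply/orP; left; apply/eqP; field.
by rewrite !gt_eqF.
Qed.

End New_sample.

(** * Fold averages *)

Section Quadratic_term.
Context {R : realType} {dS} {Sp : measurableType dS} (E : experiment R Sp).
Local Notation K := (arms E).
Local Notation n := (draws E).
Local Notation N := (nobs E).
Local Notation smp := (sample Sp R K n).
Local Notation cell := ('I_K * 'I_n)%type.
Hypotheses (spl : split_sampling E) (K_gt0 : (0 < K)%N) (iid : iid_data E).

Let S := data_product_sample iid.

Let n_gt0 : (0 < n)%N. Proof. by have [] := spl. Qed.
Let N_gt0 : (0 < N)%N. Proof. by rewrite muln_gt0 n_gt0. Qed.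
Let nR : (n%:R : R) != 0. Proof. by rewrite pnatr_eq0 -lt0n. Qed.
Let KR : (K%:R : R) != 0. Proof. by rewrite pnatr_eq0 -lt0n. Qed.
Let NE : (N%:R : R) = n%:R * K%:R. Proof. by rewrite natrM. Qed.

(** Each cell splits into two folds of [n / 2] draws. *)
Lemma fold_average (v : bool) (a : 'I_K) (r : R) :
  2 / n%:R * \sum_(i < n | fold a i == v) r = r.
Proof.
have [even_n _ _ half] := spl.
rewrite sumr_const -[#|_|]/(#|[pred i | fold a i == v]|) half -mulr_natl.
have -> : n%:R = 2 * (n./2)%:R :> R.
  by rewrite -natrM mul2n; congr _%:R; rewrite -[LHS]odd_double_half (negPf even_n).
have : (n./2)%:R != 0 :> R.
  rewrite pnatr_eq0; apply: contraNN even_n => /eqP n2.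
  by move: n_gt0; rewrite -[n]odd_double_half n2 addn0; case: (odd n).
by move=> n20; field.
Qed.

Lemma ThatB v x (f : fun_of_obs E) (r : 'I_K -> R) a :
  That E v x (fun a z => f a z - r a) a = That E v x f a - r a.
Proof. by rewrite /That sumrB mulrBr fold_average. Qed.

Lemma That_le v x (f : fun_of_obs E) (b : R) a : (forall z, `|f a z| <= b) ->
  `|That E v x f a| <= b.
Proof.
move=> fb; rewrite /That normrM ger0_norm ?divr_ge0//.
apply: (@le_trans _ _ (2 / n%:R * \sum_(i < n | fold a i == v) b)); last first.
  by rewrite fold_average.
rewrite ler_wpM2l ?divr_ge0//.
by rewrite (le_trans (ler_norm_sum _ _ _))// ler_sum.
Qed.

Lemma measurable_That v (f : fun_of_obs E) a : measurable_fun setT (f a) ->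
  measurable_fun setT (fun x => That E v x f a).
Proof.
move=> mf; apply: measurable_funM => //.
rewrite (_ : (fun x : smp => _) =
    fun x => \sum_(i < n) if fold a i == v then f a (obs x a i) else 0).
  apply: measurable_sum => i; case: (fold a i == v) => //.
  exact: (measurableT_comp mf (c_meas S (a, i))).
by apply/funext => x; rewrite big_mkcond.
Qed.

Lemma That_splice v (m : cell -> bool) x x' (f : fun_of_obs E) a :
  (forall ai : cell, m ai -> on_fold E (~~ v) ai) ->
  That E v (splice (cell_obs E) (of_cells E) m x x') f a = That E v x f a.
Proof.
move=> mv; congr *%R; apply: eq_bigr => i /eqP fi.
congr (f a _); apply: (etrans (c_splice S m x x' (a, i))).
by case: ifP => // /mv; rewrite /on_fold/= fi; case: (v).
Qed.

Lemma mean_That v x (f : fun_of_obs E) (r : 'I_K -> R) :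
  2 / N%:R * \sum_(ai | on_fold E v ai) r ai.1 * f ai.1 (cell_obs E ai x) =
  meanA E (fun a => r a * That E v x f a).
Proof.
rewrite -(cell_sum v (fun ai => r ai.1 * f ai.1 (cell_obs E ai x)))/= /meanA.
rewrite (_ : 2 / N%:R = K%:R^-1 * (2 / n%:R)); last by rewrite NE; field; rewrite nR KR.
rewrite -mulrA big_distrr; congr *%R; apply: eq_bigr => a _ /=.
by rewrite /That -big_distrr mulrCA.
Qed.

Lemma TK_le (f : fun_of_obs E) (b : R) a : measurable_fun setT (f a) ->
  (forall z, `|f a z| <= b) -> `|TK E f a| <= b.
Proof.
move=> mf fb; have fi := bounded_integrable (law a) mf fb.
rewrite /TK (le_trans (le_normr_Rintegral measurableT fi))//.
apply: (@le_trans _ _ (\int[law a]_z (cst b z))).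
  apply: le_Rintegral => //.
  - apply: (@bounded_integrable _ _ _ _ _ b); first exact: measurableT_comp.
    by move=> z; rewrite normr_id.
  - by apply: (@bounded_integrable _ _ _ _ _ `|b|).
rewrite Rintegral_cst// [X in fine X](_ : _ = 1%E) ?mulr1//.
exact: probability_setT.
Qed.

Lemma TK_centred (f : fun_of_obs E) (b r : R) a : measurable_fun setT (f a) ->
  (forall z, `|f a z| <= b) -> \int[law a]_z (f a z - r) = TK E f a - r.
Proof.
move=> mf fb; rewrite RintegralB//; last 2 first.
- exact: bounded_integrable fb.
- by apply: (@bounded_integrable _ _ _ _ _ `|r|).
rewrite Rintegral_cst// [X in fine X](_ : _ = 1%E) ?mulr1//.
exact: probability_setT.
Qed.

Lemma weighted_event v (F : smp -> set (fun_of_obs E)) (delta : smp -> R) (b : R)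
    zeta (W : smp -> cell -> Sp * R -> R) :
  1 <= b -> 0 < zeta -> (forall x, 0 < delta x) ->
  (forall x, bounded_obs b (F x)) ->
  rad_controlled (cell_obs E) (data_law E) (on_fold E v) (scaled F delta)
    (2 * N%:R * b) ->
  (forall ai, measurable_fun setT (fun x => W x ai (cell_obs E ai x))) ->
  (forall x ai, measurable_fun setT (W x ai)) ->
  (forall x ai z, `|W x ai z| <= 1) ->
  (forall x x' (m : cell -> bool), (forall ai, m ai -> on_fold E v ai) ->
     let y := splice (cell_obs E) (of_cells E) m x x' in
     [/\ F y = F x, delta y = delta x & W y = W x]) ->
  exists A, [/\ measurable A, ((1 - zeta)%:E <= data_law E A)%E &
    forall x f, A x -> F x f -> delta x <= 1 ->
      `|2 / N%:R * \sum_(ai | on_fold E v ai)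
          (W x ai (cell_obs E ai x) * f ai.1 (cell_obs E ai x)
          - \int[law ai.1]_z (W x ai z * f ai.1 z))| <= 8 * b / zeta * delta x].
Proof.
move=> b1 z0 d0 Fb ctrl mWx mW W1 inv.
have N0 : 0 < N%:R :> R by rewrite ltr0n.
have b0 : 0 < b := lt_le_trans ltr01 b1.
have k0 : 0 < 2 * N%:R * b by rewrite !mulr_gt0.
have [A [mA PA AP]] := scaled_event iid k0 z0 d0 Fb ctrl mWx mW W1 inv.
exists A; split=> // x f Ax Ff d1; rewrite normrM ger0_norm ?divr_ge0//.
apply: (le_trans (ler_wpM2l _ (AP x f Ax Ff d1))); first by rewrite divr_ge0.
rewrite le_eqVlt; apply/orP; left; apply/eqP; field.
by rewrite !gt_eqF.
Qed.

End Quadratic_term.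

Lemma events_and {R : realType} d (T : measurableType d) (P : probability T R)
    (A B : set T) (a b : R) : measurable A -> measurable B ->
  ((1 - a)%:E <= P A)%E -> ((1 - b)%:E <= P B)%E ->
  ((1 - (a + b))%:E <= P (A `&` B))%E.
Proof.
move=> mA mB PA PB.
have mAB : measurable (A `&` B) by exact: measurableI.
have fP C : measurable C -> P C \is a fin_num by exact: fin_num_measure.
have mD : measurable (A `\` B) by exact: measurableD.
have : (P (A `\` B) <= (1 - fine (P B))%:E)%E.
  rewrite EFinB fineK; last exact: fP.
  rewrite -probability_setC//; apply: le_measure; rewrite ?inE//.
  exact: measurableC.
have PAE : P A = (P (A `\` B) + P (A `&` B))%E := measureDI P mA mB.
move: PA PB; rewrite PAE -(fineK (fP _ mAB)) -(fineK (fP _ mD)) -EFinD.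
rewrite -{1}(fineK (fP _ mB)) !lee_fin /=; lra.
Qed.

(** * The processes of the two-fold product *)

Section Fluctuations.
Context {R : realType} {dS} {Sp : measurableType dS} (E : experiment R Sp).
Local Notation K := (arms E).
Local Notation n := (draws E).
Local Notation N := (nobs E).
Local Notation smp := (sample Sp R K n).
Local Notation cell := ('I_K * 'I_n)%type.
Hypotheses (spl : split_sampling E) (K_gt0 : (0 < K)%N) (iid : iid_data E).
Variables (H : set (Sp -> R)) (h0 : Sp -> R).
Hypotheses (H_bounded : bounded_class H) (Hh0 : H h0).

Let S := data_product_sample iid.
Let N_gt0 : (0 < N)%N. Proof. by have [_ n0 _ _] := spl; rewrite muln_gt0 n0. Qed.

Definition gap (xi : Sp -> R) : fun_of_obs E := ofS E (fun s => xi s - h0 s).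

Definition centred (f : fun_of_obs E) : fun_of_obs E :=
  fun a z => f a z - TK E f a.

Lemma ofS_le1 xi : H xi -> forall a,
  measurable_fun setT (ofS E xi a) /\ forall z, `|ofS E xi a z| <= 1.
Proof.
move=> /H_bounded[mxi xi1] a; split; last by move=> z; exact: xi1.
exact: (measurableT_comp mxi measurable_fst).
Qed.

Lemma gap_le2 xi : H xi -> forall a,
  measurable_fun setT (gap xi a) /\ forall z, `|gap xi a z| <= 2.
Proof.
move=> Hxi a; have [mxi xi1] := ofS_le1 Hxi a; have [mh h1] := ofS_le1 Hh0 a.
split; first exact: measurable_funB.
move=> z; apply: (le_trans (ler_normB (ofS E xi a z) (ofS E h0 a z))).
by have := xi1 z; have := h1 z; lra.
Qed.

Lemma TK_gap xi a : H xi -> TK E (ofS E xi) a = TK E (gap xi) a + TK E (ofS E h0) a.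
Proof.
move=> Hxi; have [mxi xi1] := ofS_le1 Hxi a; have [mh h1] := ofS_le1 Hh0 a.
rewrite /TK -[X in _ = X + _]/(\int[law a]_z (ofS E xi a z - ofS E h0 a z)).
have ixi := bounded_integrable (law a) mxi xi1.
have ih := bounded_integrable (law a) mh h1.
by rewrite (RintegralB measurableT ixi ih) subrK.
Qed.

Lemma centred_le (f : fun_of_obs E) (b : R) a :
  measurable_fun setT (f a) -> (forall z, `|f a z| <= b) ->
  measurable_fun setT (centred f a) /\ forall z, `|centred f a z| <= b + b.
Proof.
move=> mf fb; split; first exact: measurable_funB.
by move=> z; rewrite (le_trans (ler_normB _ _))// lerD// TK_le.
Qed.

Lemma centred_mean (f : fun_of_obs E) (b r : R) a :
  measurable_fun setT (f a) -> (forall z, `|f a z| <= b) ->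
  \int[law a]_z (r * centred f a z) = 0.
Proof.
move=> mf fb; have [mcf cfb] := centred_le mf fb.
rewrite RintegralZl//; last exact: bounded_integrable mcf cfb.
by rewrite (TK_centred _ mf fb) subrr mulr0.
Qed.

Lemma centred_gap_le4 xi : H xi -> forall a, measurable_fun setT (centred (gap xi) a) /\
  forall z, `|centred (gap xi) a z| <= 4.
Proof.
move=> Hxi a; have [mg g2] := gap_le2 Hxi a.
by have [mc c4] := centred_le mg g2; split=> // z; rewrite (le_trans (c4 z))//; lra.
Qed.

Lemma That_gap v x xi a : H xi -> That E v x (ofS E xi) a =
  That E v x (centred (gap xi)) a + TK E (gap xi) a + That E v x (ofS E h0) a.
Proof.
move=> Hxi; rewrite (ThatB spl) subrK /That -mulrDr -big_split/=; congr *%R.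
by apply: eq_bigr => i _; rewrite /gap /ofS subrK.
Qed.

Lemma fixed_class_event v (F : set (fun_of_obs E)) (delta b zeta : R)
    (W : smp -> cell -> Sp * R -> R) :
  1 <= b -> 0 < zeta -> F !=set0 -> bounded_obs b F -> solves E F delta ->
  (forall ai, measurable_fun setT (fun x => W x ai (cell_obs E ai x))) ->
  (forall x ai, measurable_fun setT (W x ai)) ->
  (forall x ai z, `|W x ai z| <= 1) ->
  (forall x x' (m : cell -> bool), (forall ai, m ai -> on_fold E v ai) ->
     W (splice (cell_obs E) (of_cells E) m x x') = W x) ->
  exists A, [/\ measurable A, ((1 - zeta)%:E <= data_law E A)%E &
    forall x f, A x -> F f -> delta <= 1 ->
      `|2 / N%:R * \sum_(ai | on_fold E v ai)
          (W x ai (cell_obs E ai x) * f ai.1 (cell_obs E ai x)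
          - \int[law ai.1]_z (W x ai z * f ai.1 z))| <= 8 * b / zeta * delta].
Proof.
move=> b1 z0 F0 Fb sol mWx mW W1 inv; have [d0 _] := sol.
have ctrl := rad_controlled_fold spl iid v (rad_controlled_solves N_gt0 b1 F0 Fb sol).
have [|A AP] := weighted_event spl K_gt0 iid b1 z0 (fun=> d0) (fun=> Fb) ctrl mWx mW W1.
  by move=> x x' m mv; split=> //; exact: inv.
by exists A.
Qed.

(** The multiplier is an average over the other fold, so it is fixed while the
    process over the fold [v] is symmetrized. *)
Lemma centred_gap_event v dtil zeta : 0 < zeta -> solves E (G0 E H h0) dtil ->
  exists A, [/\ measurable A, ((1 - zeta)%:E <= data_law E A)%E &
  forall x xi, A x -> H xi -> dtil <= 1 ->
    `|meanA E (fun a => That E (~~ v) x (ofS E h0) a * That E v x (centred (gap xi)) a)|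
      <= 8 * 4 / zeta * dtil].
Proof.
move=> z0 sol; have h1 := ofS_le1 Hh0.
have Fb : bounded_obs 4 (G0 E H h0).
  by move=> _ [_ [xi Hxi <-] <-] a; exact: (centred_gap_le4 Hxi a).
have F0 : G0 E H h0 !=set0.
  by exists (centred (gap h0)), (gap h0) => //; exists h0.
have b1 : 1 <= 4 :> R by lra.
have [||||A [mA PA AP]] := fixed_class_event (v := v)
  (W := fun x ai _ => That E (~~ v) x (ofS E h0) ai.1) b1 z0 F0 Fb sol.
- by move=> ai; apply: measurable_That => //; have [] := h1 ai.1.
- by move=> x ai; exact: measurable_cst.
- by move=> x ai z; apply: That_le => //; have [] := h1 ai.1.
- move=> x x' m mv; apply/funext => ai; apply/funext => z.
  by apply: That_splice => // ai'; rewrite negbK; exact: mv.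
exists A; split=> // x xi Ax Hxi d1.
have Gxi : G0 E H h0 (centred (gap xi)) by exists (gap xi) => //; exists xi.
apply: le_trans (AP x _ Ax Gxi d1); rewrite -(mean_That spl K_gt0).
rewrite le_eqVlt; apply/orP; left; apply/eqP.
congr (`| _ * _ |); apply: eq_bigr => ai _.
have [mg g2] := gap_le2 Hxi ai.1.
by rewrite (centred_mean _ mg g2) subr0.
Qed.

Lemma TK_gap_le2 xi a : H xi -> `|TK E (gap xi) a| <= 2.
Proof. by move=> Hxi; have [mg g2] := gap_le2 Hxi a; exact: TK_le. Qed.

(** Here the class consists of functions of the arm alone, and the randomness
    comes from the multiplier, the noise of [h0]. That noise is at most 2, hence
    the factor [2^-1] that makes it a weight. *)
Lemma centred_h0_event v dbreve zeta : 0 < zeta -> solves E (TG E H h0) dbreve ->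
  exists A, [/\ measurable A, ((1 - zeta)%:E <= data_law E A)%E &
  forall x xi, A x -> H xi -> dbreve <= 1 ->
    `|meanA E (fun a => TK E (gap xi) a * That E v x (centred (ofS E h0)) a)|
      <= 2 * (8 * 2 / zeta * dbreve)].
Proof.
move=> z0 sol; have h1 := ofS_le1 Hh0.
have Fb : bounded_obs 2 (TG E H h0).
  move=> _ [_ [xi Hxi <-] <-] a; split; first exact: measurable_cst.
  by move=> z; exact: TK_gap_le2.
have F0 : TG E H h0 !=set0.
  by exists (fun a _ => TK E (gap h0) a), (gap h0) => //; exists h0.
have b1 : 1 <= 2 :> R by lra.
pose c0 := centred (ofS E h0).
have c0P a : measurable_fun setT (c0 a) /\ forall z, `|c0 a z| <= 1 + 1.
  by have [mh hb] := h1 a; exact: centred_le.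
have mc0 (ai : cell) : measurable_fun setT (fun z => 2^-1 * c0 ai.1 z).
  by apply: measurable_funM => //; have [] := c0P ai.1.
have [||||A [mA PA AP]] := fixed_class_event (v := v)
  (W := fun x ai z => 2^-1 * c0 ai.1 z) b1 z0 F0 Fb sol.
- by move=> ai; exact: (measurableT_comp (mc0 ai) (c_meas S ai)).
- by move=> x ai; exact: mc0.
- move=> x ai z; rewrite normrM ger0_norm// ler_pdivrMl// mulr1.
  by have [_] := c0P ai.1; exact.
- by [].
exists A; split=> // x xi Ax Hxi d1.
have Gxi : TG E H h0 (fun a _ => TK E (gap xi) a) by exists (gap xi) => //; exists xi.
apply: le_trans (ler_wpM2l _ (AP x _ Ax Gxi d1)); last by [].
rewrite -(mean_That spl K_gt0) -[X in _ <= X * _]ger0_norm// -normrM.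
rewrite le_eqVlt; apply/orP; left; apply/eqP; congr `| _ |.
rewrite [RHS]mulrCA; congr *%R; rewrite big_distrr/=; apply: eq_bigr => ai _.
have [mh hb] := h1 ai.1.
under eq_Rintegral do rewrite mulrAC.
rewrite (centred_mean _ mh hb) subr0.
by rewrite /c0; field.
Qed.

(** Centring the product [g * TK g] of [G1] replaces [g] by its noise. *)
Lemma cross_gap_event v dbar zeta : 0 < zeta -> solves E (G1 E H h0) dbar ->
  exists A, [/\ measurable A, ((1 - zeta)%:E <= data_law E A)%E &
  forall x xi, A x -> H xi -> dbar <= 1 ->
    `|meanA E (fun a => TK E (gap xi) a * That E v x (centred (gap xi)) a)|
      <= 8 * 4 / zeta * dbar].
Proof.
move=> z0 sol.
have Fb : bounded_obs 4 (G1 E H h0).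
  move=> _ [_ [xi Hxi <-] <-] a; have [mg g2] := gap_le2 Hxi a; split.
    exact: measurable_funM.
  move=> z; rewrite normrM (_ : 4 = 2 * 2); last by ring.
  by apply: ler_pM => //; [exact: g2|exact: TK_gap_le2].
have F0 : G1 E H h0 !=set0.
  by exists (fun a z => gap h0 a z * TK E (gap h0) a), (gap h0) => //; exists h0.
have b1 : 1 <= 4 :> R by lra.
have [||||A [mA PA AP]] := fixed_class_event (v := v)
  (W := fun x ai z => 1) b1 z0 F0 Fb sol => //.
- by move=> x ai z; rewrite normr1.
exists A; split=> // x xi Ax Hxi d1.
have Gxi : G1 E H h0 (fun a z => gap xi a z * TK E (gap xi) a).
  by exists (gap xi) => //; exists xi.
apply: le_trans (AP x _ Ax Gxi d1); rewrite -(mean_That spl K_gt0).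
rewrite le_eqVlt; apply/orP; left; apply/eqP.
congr (`| _ * _ |); apply: eq_bigr => ai _.
have [mg g2] := gap_le2 Hxi ai.1.
under eq_Rintegral do rewrite mul1r.
rewrite RintegralZr//; last exact: bounded_integrable mg g2.
by rewrite /centred /TK; ring.
Qed.

(** Over fold 1 the class is [Ghat], whose elements carry the average over fold
    0 as a coefficient. *)
Lemma product_event dhat zeta : 0 < zeta -> solves_cond0 E (Ghat E H h0) dhat ->
  exists A, [/\ measurable A, ((1 - zeta)%:E <= data_law E A)%E &
  forall x xi, A x -> H xi -> dhat x <= 1 ->
    `|meanA E (fun a => That E false x (centred (gap xi)) a *
        That E true x (centred (gap xi)) a)|
      <= 8 * 16 / zeta * dhat x].
Proof.
move=> z0 sol; have [[md dD0] d0 _] := sol.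
have Fb x : bounded_obs 16 (Ghat E H h0 x).
  move=> _ [_ [_ [xi Hxi <-] <-] <-] a; have [mc c4] := centred_gap_le4 Hxi a; split.
    exact: measurable_funM.
  move=> z; rewrite normrM (_ : 16 = 4 * 4); last by ring.
  by rewrite ler_pM//; [exact: c4|exact: That_le].
have Ghat_in x xi : H xi -> Ghat E H h0 x
    (fun a z => centred (gap xi) a z * That E false x (centred (gap xi)) a).
  by move=> Hxi; exists (centred (gap xi)) => //; exists (gap xi) => //; exists xi.
have F0 x : Ghat E H h0 x !=set0 by eexists; exact: Ghat_in Hh0.
have b1 : 1 <= 16 :> R by lra.
have ctrl := rad_controlled_solves_cond0 N_gt0 iid b1 F0 Fb sol.
have [||||A [mA PA AP]] := weighted_event spl K_gt0 iid (W := fun x ai z => 1)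
  b1 z0 d0 Fb ctrl => //.
- by move=> x ai z; rewrite normr1.
- move=> x x' m mv y.
  have yD0 : same_D0 E y x.
    move=> a i ai; apply: (etrans (c_splice S m x x' (a, i))).
    by case: ifP => // /mv; rewrite /on_fold/= ai.
  split=> //; last exact: dD0.
  apply/seteqP; split=> _ [g Gg <-]; exists g => //; apply/funext => a;
    apply/funext => z; congr *%R; [apply/esym|];
    by apply: That_splice => // ai'; exact: mv.
exists A; split=> // x xi Ax Hxi d1.
apply: le_trans (AP x _ Ax (Ghat_in x xi Hxi) d1); rewrite -(mean_That spl K_gt0).
rewrite le_eqVlt; apply/orP; left; apply/eqP.
congr (`| _ * _ |); apply: eq_bigr => ai _.
have [mg g2] := gap_le2 Hxi ai.1.
under eq_Rintegral do rewrite mul1r mulrC.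
by rewrite (centred_mean _ mg g2) subr0 mul1r mulrC.
Qed.

End Fluctuations.

(** * The minimizer of the risk *)

Section Risk.
Context {R : realType} {dS} {Sp : measurableType dS} (E : experiment R Sp).
Local Notation K := (arms E).
Local Notation smp := (sample Sp R K (draws E)).
Hypotheses (spl : split_sampling E) (K_gt0 : (0 < K)%N) (iid : iid_data E).
Variables (H : set (Sp -> R)) (h0 : Sp -> R).
Hypotheses (H_bounded : bounded_class H) (Hh0 : H h0).

Lemma meanAD (u v : 'I_K -> R) :
  meanA E (fun a => u a + v a) = meanA E u + meanA E v.
Proof. by rewrite /meanA big_split mulrDr. Qed.

Lemma meanAZ r (u : 'I_K -> R) : meanA E (fun a => r * u a) = r * meanA E u.
Proof. by rewrite /meanA -big_distrr mulrCA. Qed.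

Lemma meanAB (u v : 'I_K -> R) :
  meanA E (fun a => u a - v a) = meanA E u - meanA E v.
Proof. by rewrite /meanA sumrB mulrBr. Qed.

Definition fold_product (x : smp) (xi : Sp -> R) : R :=
  meanA E (fun a => That E false x (ofS E xi) a * That E true x (ofS E xi) a).

Definition TK_square (xi : Sp -> R) : R :=
  meanA E (fun a => TK E (ofS E xi) a ^+ 2).

Lemma fold_product_expansion x xi : H xi ->
  let That0 v := That E v x (ofS E h0) in
  let noise v := That E v x (centred (gap h0 xi)) in
  let T := TK E (gap h0 xi) in
  let noise0 v := That E v x (centred (ofS E h0)) in
  (fold_product x xi - TK_square xi) - (fold_product x h0 - TK_square h0) =
  meanA E (fun a => noise false a * noise true a)
  + (meanA E (fun a => T a * noise false a) + meanA E (fun a => T a * noise true a))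
  + (meanA E (fun a => That0 true a * noise false a)
     + meanA E (fun a => That0 false a * noise true a))
  + (meanA E (fun a => T a * noise0 false a) + meanA E (fun a => T a * noise0 true a)).
Proof.
move=> Hxi /=; rewrite -!(meanAB, meanAD); congr (meanA E _); apply/funext => a.
rewrite !(That_gap spl h0 _ _ _ Hxi) (TK_gap H_bounded Hh0 _ Hxi).
rewrite !(ThatB spl); ring.
Qed.

Lemma fold_product_event dtil dbar dbreve dhat zeta : 0 < zeta ->
  solves E (G0 E H h0) dtil -> solves E (G1 E H h0) dbar ->
  solves E (TG E H h0) dbreve -> solves_cond0 E (Ghat E H h0) dhat ->
  exists A, [/\ measurable A, ((1 - 7 * zeta)%:E <= data_law E A)%E &
    forall x xi D, A x -> H xi -> dtil <= D -> dhat x <= D -> dbar <= D ->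
      dbreve <= D -> D <= 1 ->
      `|(fold_product x xi - TK_square xi) - (fold_product x h0 - TK_square h0)|
        <= 320 / zeta * D].
Proof.
move=> z0 s0 s1 sT shat.
have [A1 [mA1 P1 E1]] := centred_gap_event spl K_gt0 iid H_bounded Hh0 false z0 s0.
have [A2 [mA2 P2 E2]] := centred_gap_event spl K_gt0 iid H_bounded Hh0 true z0 s0.
have [A3 [mA3 P3 E3]] := centred_h0_event spl K_gt0 iid H_bounded Hh0 false z0 sT.
have [A4 [mA4 P4 E4]] := centred_h0_event spl K_gt0 iid H_bounded Hh0 true z0 sT.
have [A5 [mA5 P5 E5]] := cross_gap_event spl K_gt0 iid H_bounded Hh0 false z0 s1.
have [A6 [mA6 P6 E6]] := cross_gap_event spl K_gt0 iid H_bounded Hh0 true z0 s1.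
have [A7 [mA7 P7 E7]] := product_event spl K_gt0 iid H_bounded Hh0 z0 shat.
have m12 := measurableI _ _ mA1 mA2; have p12 := events_and mA1 mA2 P1 P2.
have m3 := measurableI _ _ m12 mA3; have p3 := events_and m12 mA3 p12 P3.
have m4 := measurableI _ _ m3 mA4; have p4 := events_and m3 mA4 p3 P4.
have m5 := measurableI _ _ m4 mA5; have p5 := events_and m4 mA5 p4 P5.
have m6 := measurableI _ _ m5 mA6; have p6 := events_and m5 mA6 p5 P6.
have m7 := measurableI _ _ m6 mA7; have p7 := events_and m6 mA7 p6 P7.
exists (A1 `&` A2 `&` A3 `&` A4 `&` A5 `&` A6 `&` A7); split=> //.
  by apply: le_trans p7; rewrite lee_fin le_eqVlt; apply/orP; left; apply/eqP; ring.
move=> x xi D [[[[[[a1 a2] a3] a4] a5] a6] a7] Hxi lt0 lhat l1 lT D1.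
have k0 (k d : R) : 0 <= k -> d <= D -> k / zeta * d <= k / zeta * D.
  by move=> kk dD; rewrite ler_wpM2l// divr_ge0// ltW.
have [e32 e16 e128] : [/\ 0 <= 8 * 4 :> R, 0 <= 8 * 2 :> R & 0 <= 8 * 16 :> R].
  by rewrite !mulr_ge0.
have {}E1 := le_trans (E1 x xi a1 Hxi (le_trans lt0 D1)) (k0 _ _ e32 lt0).
have {}E2 := le_trans (E2 x xi a2 Hxi (le_trans lt0 D1)) (k0 _ _ e32 lt0).
have {}E3 := le_trans (E3 x xi a3 Hxi (le_trans lT D1))
  (ler_wpM2l (ler0n _ _) (k0 _ _ e16 lT)).
have {}E4 := le_trans (E4 x xi a4 Hxi (le_trans lT D1))
  (ler_wpM2l (ler0n _ _) (k0 _ _ e16 lT)).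
have {}E5 := le_trans (E5 x xi a5 Hxi (le_trans l1 D1)) (k0 _ _ e32 l1).
have {}E6 := le_trans (E6 x xi a6 Hxi (le_trans l1 D1)) (k0 _ _ e32 l1).
have {}E7 := le_trans (E7 x xi a7 Hxi (le_trans lhat D1)) (k0 _ _ e128 lhat).
rewrite fold_product_expansion//.
have sum7 (k t1 t2 t3 t4 t5 t6 t7 : R) : `|t7| <= 128 * k ->
    `|t5| <= 32 * k -> `|t6| <= 32 * k -> `|t1| <= 32 * k -> `|t2| <= 32 * k ->
    `|t3| <= 32 * k -> `|t4| <= 32 * k ->
    `|t7 + (t5 + t6) + (t1 + t2) + (t3 + t4)| <= 320 * k.
  rewrite !ler_norml => /andP[? ?] /andP[? ?] /andP[? ?] /andP[? ?] /andP[? ?].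
  by move=> /andP[? ?] /andP[? ?]; apply/andP; split; lra.
move: E1 E2 E3 E4 E5 E6 E7.
have -> : 8 * 4 / zeta * D = 32 * (D / zeta) by field; rewrite gt_eqF.
have -> : 2 * (8 * 2 / zeta * D) = 32 * (D / zeta) by field; rewrite gt_eqF.
have -> : 8 * 16 / zeta * D = 128 * (D / zeta) by field; rewrite gt_eqF.
have -> : 320 / zeta * D = 320 * (D / zeta) by field; rewrite gt_eqF.
by move=> E1 E2 E3 E4 E5 E6 E7; exact: sum7.
Qed.
Lemma sq_norm_emp_itv x h : H h -> 0 <= sq_norm_emp E x h <= 1.
Proof.
move=> /H_bounded[_ h1]; have [_ n0 _ _] := spl.
have N0 : 0 < (nobs E)%:R :> R by rewrite ltr0n muln_gt0 n0.
apply/andP; split.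
  by rewrite mulr_ge0// sumr_ge0// => a _; rewrite sumr_ge0// => i _; exact: sqr_ge0.
rewrite ler_pdivrMl// mulr1.
apply: (@le_trans _ _ (\sum_(a < K) \sum_(i < draws E) 1)).
  apply: ler_sum => a _; apply: ler_sum => i _.
  by rewrite -[leLHS]real_normK ?num_real// exprn_ile1.
by rewrite !sumr_const !card_ord -mulrnA lexx.
Qed.

Lemma sqr_normA u : normA E u ^+ 2 = meanA E (fun a => u a ^+ 2).
Proof.
rewrite sqr_sqrtr// /meanA mulr_ge0// sumr_ge0// => a _; exact: sqr_ge0.
Qed.

Lemma TK_sub xi xi' a : H xi -> H xi' ->
  TK E (ofS E (fun s => xi s - xi' s)) a = TK E (ofS E xi) a - TK E (ofS E xi') a.
Proof. by move=> Hxi Hxi'; rewrite (TK_gap H_bounded Hxi' a Hxi) addrK. Qed.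

(** Subtract the inequality [risk xi <= risk xi0] from the expansion of the
    squared norm, in which [theta xi0] is the squared norm of [TK xi0]; the
    terms in [h0] cancel and the penalty of [xi0] is at most [mu]. *)
Lemma minimizer_gap mu x y xi xi0 : 0 <= mu ->
  (forall h, H h ->
     theta E h = meanA E (fun a => TK E (ofS E xi0) a * TK E (ofS E h) a)) ->
  minimizes_risk E mu H x y xi -> H xi0 ->
  normA E (TK E (ofS E (fun s => xi s - xi0 s))) ^+ 2 <=
    2 * `|(new_draws E)%:R^-1 *
          (\sum_(i < new_draws E) (xi (tnth y i) - xi0 (tnth y i)))
          - (theta E xi - theta E xi0)|
    + `|(fold_product x xi - TK_square xi) - (fold_product x h0 - TK_square h0)|
    + `|(fold_product x xi0 - TK_square xi0) - (fold_product x h0 - TK_square h0)|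
    + 2 * mu.
Proof.
move=> mu0 thetaE [Hxi xi_min] Hxi0.
have riskE h : risk E mu x y h = 2^-1 * fold_product x h
    - (new_draws E)%:R^-1 * (\sum_(i < new_draws E) h (tnth y i))
    + mu * sq_norm_emp E x h.
  by rewrite /risk /fold_product /meanA invfM mulrA.
have normE : normA E (TK E (ofS E (fun s => xi s - xi0 s))) ^+ 2 =
    TK_square xi - 2 * theta E xi + theta E xi0.
  rewrite sqr_normA (thetaE _ Hxi) (thetaE _ Hxi0) -meanAZ -meanAB -meanAD.
  by congr (meanA E _); apply/funext => a; rewrite TK_sub//; ring.
have theta0 : theta E xi0 = TK_square xi0.
  by rewrite thetaE//; congr (meanA E _); apply/funext => a; rewrite expr2.
have := xi_min xi0 Hxi0; rewrite !riskE normE sumrB mulrBr.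
have /andP[e0 e1] := sq_norm_emp_itv x Hxi.
have /andP[e00 e01] := sq_norm_emp_itv x Hxi0.
have := mulr_ge0 mu0 e0; have := ler_wpM2l mu0 e01; rewrite mulr1.
set P1 := _ * \sum_(i < _) xi _; set P0 := _ * \sum_(i < _) xi0 _.
set D := fold_product x h0 - TK_square h0.
have := ler_norm (P1 - P0 - (theta E xi - theta E xi0)).
have := ler_norm (fold_product x xi0 - TK_square xi0 - D).
have := ler_norm (- (fold_product x xi - TK_square xi - D)); rewrite normrN.
rewrite theta0; lra.
Qed.

Lemma normA_le2 xi xi' : H xi -> H xi' ->
  normA E (TK E (ofS E (fun s => xi s - xi' s))) <= 2.
Proof.
move=> Hxi Hxi'; rewrite -(@ler_pXn2r _ 2)// ?nnegrE ?sqrtr_ge0//.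
rewrite sqr_normA /meanA ler_pdivrMl ?ltr0n//.
apply: (@le_trans _ _ (\sum_(a < K) 2 ^+ 2)).
  apply: ler_sum => a _; rewrite -[leLHS]real_normK ?num_real// lerXn2r ?nnegrE//.
  exact: (TK_gap_le2 H_bounded Hxi' a Hxi).
by rewrite sumr_const card_ord mulr_natl.
Qed.

End Risk.

(** The seven events of the two-fold product and the one of the new sample give
    [8 * zeta]. As [zeta < 1], the bounds in [zeta^-1] on the square are also
    bounds in [zeta^-2], and 26 is the root of a square above the constant 640
    of the expansion. *)
Lemma estimation_bound {R : realType} {dS} {Sp : measurableType dS}
    (E : experiment R Sp) (H : set (Sp -> R)) (h0 rho alpha xi0 : Sp -> R)
    (Tstar : ('I_(arms E) -> R) -> Sp -> R) (mu rnew dtil dbar dbreve zeta : R)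
    (dhat : sample Sp R (arms E) (draws E) -> R) (xihat : Omega E -> Sp -> R) :
  let dN x := Num.max (Num.max dtil (dhat x)) (Num.max dbar dbreve) in
  (0 < arms E)%N -> 0 < zeta -> zeta < 1 ->
  split_sampling E -> iid_data E -> iid_new E -> bounded_class H -> H h0 ->
  density_ratio E rho -> is_projection E (closed_span E H) rho alpha ->
  is_adjoint E (closed_span E H) Tstar -> Xi E H Tstar alpha xi0 -> 0 < mu ->
  (forall w, minimizes_risk E mu H (data E w) (data_new E w) (xihat w)) ->
  solves E (G0 E H h0) dtil -> solves E (G1 E H h0) dbar ->
  solves E (TG E H h0) dbreve -> solves_cond0 E (Ghat E H h0) dhat ->
  0 <= rnew -> (complexity_new E H 1 <= (rnew ^+ 2)%:E)%E ->
  exists A : set (Omega E),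
    [/\ measurable A, ((1 - 8 * zeta)%:E <= Pr E A)%E &
      forall w, A w ->
        normA E (TK E (ofS E (fun s => xihat w s - xi0 s)))
        <= 26 / zeta * (Num.sqrt (dN (data E w)) + rnew + Num.sqrt mu)].
Proof.
move=> dN K0 z0 z1 spl iid iidn Hb Hh0 drho proj adj Xi0 mu0 xihat_min s0 s1 sT shat r0 hr.
have [_ _ nnew0 _] := spl; have [Hxi0 _] := Xi0.
have [A1 [mA1 P1 E1]] := fold_product_event spl K0 iid Hb Hh0 z0 s0 s1 sT shat.
(* The penalty [mu] absorbs the gap between the infimum that defines the
   complexity and the mean of an actual majorant. *)
pose r := rnew ^+ 2 + mu.
have rpos : 0 < r by rewrite ltr_wpDl// sqr_ge0.
have hr' : (complexity_new E H 1 < r%:E)%E.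
  by rewrite (le_lt_trans hr)// lte_fin ltrDl.
have [A2 [mA2 P2 E2]] := new_event Hb nnew0 iidn Hxi0 hr' rpos z0.
have mB1 : measurable (data E @^-1` A1) by exact: measurable_funPTI.
have mB2 : measurable (data_new E @^-1` A2) by exact: measurable_funPTI.
exists (data E @^-1` A1 `&` data_new E @^-1` A2); split.
- exact: measurableI.
- apply: (le_trans _ (events_and mB1 mB2 P1 P2)); rewrite lee_fin; lra.
move=> w [A1w A2w]; have [Hxi _] := xihat_min w.
set x := data E w; set D := dN x.
set q := normA _ _; have q0 : 0 <= q by exact: sqrtr_ge0.
have D0 : 0 < D by rewrite /D /dN !lt_max; have [-> _] := s0.
have zV : 1 <= zeta^-1 by rewrite -[1]invr1 lef_pV2 ?posrE// ltW.
have sD := sqrtr_ge0 D; have smu := sqrtr_ge0 mu.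
(* Beyond radius 1 the bound follows from [|TK (xihat - xi0)| <= 2]. *)
have [D1|D1] := leP D 1; last first.
  have s1D : 1 <= Num.sqrt D by rewrite -[1]sqrtr1 ler_sqrt// ltW.
  apply: (@le_trans _ _ 2); first exact: (normA_le2 K0 Hb Hxi Hxi0).
  apply: (@le_trans _ _ (26 * 1 * 1)); first lra.
  by apply: ler_pM => //; [rewrite ler_wpM2l|lra].
have thetaE h := theta_inner Hb drho proj adj Xi0 (h := h).
have gap := minimizer_gap spl K0 h0 Hb (ltW mu0) thetaE (xihat_min w) Hxi0.
have [dt [dh [db dbr]]] : dtil <= D /\ dhat x <= D /\ dbar <= D /\ dbreve <= D.
  by rewrite /D /dN !le_max !lexx !orbT.
have F1 := E1 x _ D A1w Hxi dt dh db dbr D1.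
have F0 := E1 x _ D A1w Hxi0 dt dh db dbr D1.
have F2 := E2 (data_new E w) _ A2w Hxi.
set s := Num.sqrt D + rnew + Num.sqrt mu.
have s_ge0 : 0 <= s by rewrite !addr_ge0.
rewrite -(@ler_pXn2r _ 2)// ?nnegrE//; last by rewrite mulr_ge0// divr_ge0// ltW.
have s2 : D + rnew ^+ 2 + mu <= s ^+ 2.
  rewrite -{1}(sqr_sqrtr (ltW D0)) -{1}(sqr_sqrtr (ltW mu0)) /s; nra.
have q2 : q ^+ 2 <= 676 * (zeta^-1 * s ^+ 2).
  apply: (le_trans gap); move: F1 F0 F2; rewrite /r.
  have -> : 320 / zeta * D = 320 * (zeta^-1 * D) by rewrite -mulrA.
  have -> : 4 * (rnew ^+ 2 + mu) / zeta = 4 * (zeta^-1 * rnew ^+ 2) + 4 * (zeta^-1 * mu).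
    by ring.
  have := ler_wpM2l (le_trans ler01 zV) s2; rewrite !mulrDr.
  have : mu <= zeta^-1 * mu by rewrite ler_peMl// ltW.
  have : 0 <= zeta^-1 * D by rewrite mulr_ge0// ltW// (lt_le_trans ltr01).
  have : 0 <= zeta^-1 * rnew ^+ 2 by rewrite mulr_ge0 ?sqr_ge0// (le_trans ler01).
  lra.
apply: (le_trans q2).
have -> : (26 / zeta * s) ^+ 2 = 676 * (zeta^-1 * (zeta^-1 * s ^+ 2)) by ring.
apply: ler_wpM2l; first exact: ler0n.
by rewrite ler_peMl// mulr_ge0 ?sqr_ge0// (le_trans ler01).
Qed.

Unset Implicit Arguments.

Theorem theorem6 (R : realType) :
  exists (c C : R) (p : nat), 0 < c /\ 0 < C /\
  forall (dS : measure_display) (Sp : measurableType dS)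
    (E : nat -> experiment R Sp)
    (H : nat -> set (Sp -> R))
    (h0 hstar rho alpha xi0 : nat -> Sp -> R)
    (Tstar : forall m, ('I_(arms (E m)) -> R) -> Sp -> R)
    (mu rnew dtil dbar dbreve dtil_n : nat -> R)
    (dhat : forall m, sample Sp R (arms (E m)) (draws (E m)) -> R)
    (xihat : forall m, Omega (E m) -> Sp -> R)
    (zeta : R),
  let V := fun m => closed_span (E m) (H m) in
  let dN := fun m x =>
    Num.max (Num.max (dtil m) (dhat m x)) (Num.max (dbar m) (dbreve m)) in
  let N := fun m => (nobs (E m))%:R : R in
  0 < zeta ->
  arms (E m) @[m --> \oo] --> \oo ->
  (forall m, split_sampling (E m)) ->
  (forall m, iid_data (E m)) ->
  (forall m, iid_new (E m)) ->
  (forall m, outcome_bounded (E m)) ->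
  (forall m, bounded_class (H m)) ->
  (forall m, L2S (E m) (hstar m) /\ bridges (E m) (hstar m)) ->
  (forall m, H m (h0 m) /\ bridges (E m) (h0 m)) ->
  (forall m, density_ratio (E m) (rho m)) ->
  (forall m, is_projection (E m) (V m) (rho m) (alpha m)) ->
  (forall m, is_adjoint (E m) (V m) (Tstar m)) ->
  (forall m, identified (E m) (V m) (hstar m)) ->
  (forall m, Xi (E m) (H m) (Tstar m) (alpha m) !=set0) ->
  (forall m, min_norm_in (E m) (Xi (E m) (H m) (Tstar m) (alpha m)) (xi0 m)) ->
  (forall m, 0 < mu m) ->
  (forall m w, minimizes_risk (E m) (mu m) (H m)
     (data (E m) w) (data_new (E m) w) (xihat m w)) ->
  (forall m, solves (E m) (G0 (E m) (H m) (h0 m)) (dtil m)) ->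
  (forall m, solves (E m) (G1 (E m) (H m) (h0 m)) (dbar m)) ->
  (forall m, solves (E m) (TG (E m) (H m) (h0 m)) (dbreve m)) ->
  (forall m, solves_arms (E m) (G0 (E m) (H m) (h0 m)) (dtil_n m)) ->
  (forall m, solves_cond0 (E m) (Ghat (E m) (H m) (h0 m)) (dhat m)) ->
  (forall m, 0 <= rnew m /\
     (complexity_new (E m) (H m) 1 <= (rnew m ^+ 2)%:E)%E) ->
  (fun m => Num.sqrt (ln ((arms (E m))%:R / zeta) / (draws (E m))%:R))
    =o_\oo dtil_n ->
  (* little-o in probability, delta_N being a function of D_0 *)
  (forall eps eta : R, 0 < eps -> 0 < eta -> \forall m \near \oo,
     (Pr (E m) [set w | (eps * dN m (data (E m) w) <
        Num.sqrt (ln (ln (dN m (data (E m) w))^-1) / N m))%R] <= eta%:E)%E) ->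
  \forall m \near \oo,
    exists A : set (Omega (E m)),
      [/\ measurable A, ((1 - c * zeta)%:E <= Pr (E m) A)%E &
        forall w, A w ->
          normA (E m) (TK (E m) (ofS (E m) (fun s => xihat m w s - xi0 m s)))
          <= C * ln (N m / zeta) ^+ p *
             (Num.sqrt (dN m (data (E m) w)) + rnew m + Num.sqrt (mu m))].
Proof.
exists 8, 26, 1%N; split; [by []|split; [by []|]].
move=> dS Sp E H h0 hstar rho alpha xi0 Tstar mu rnew dtil dbar dbreve dtil_n dhat
  xihat zeta V dN N z0 Koo spl iid iidn _ Hb _ hh0 drho proj adj _ _ mn mu0 xmin
  s0 s1 sT _ shat hr _ _.
(* For [zeta >= 1] the probability required is negative. *)
have [z1|z1] := leP 1 zeta.
  apply: nearW => m; exists set0; split => //.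
  by rewrite measure0 lee_fin; lra.
(* From [M] arms on, [ln (N / zeta) >= zeta^-1]. *)
pose M := Num.bound (expR zeta^-1).
have /cvgnyPge/(_ M) := Koo; apply: filterS => m MK.
have expM : expR zeta^-1 < M%:R by apply: archi_boundP; exact: expR_ge0.
have M0 : (0 < M)%N by rewrite -(ltr0n R) (le_lt_trans (expR_ge0 _) expM).
have K0 : (0 < arms (E m))%N := leq_trans M0 MK.
have [Hh0 _] := hh0 m; have [Xi0 _] := mn m; have [r0 cr] := hr m.
have [A [mA PA AP]] := estimation_bound K0 z0 z1 (spl m) (iid m) (iidn m) (Hb m)
  Hh0 (drho m) (proj m) (adj m) Xi0 (mu0 m) (xmin m) (s0 m) (s1 m) (sT m) (shat m) r0 cr.
exists A; split=> // w Aw; apply: (le_trans (AP w Aw)).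
rewrite ler_wpM2r ?addr_ge0 ?sqrtr_ge0// expr1 ler_wpM2l//.
have [_ n0 _ _] := spl m.
have KN : (M%:R : R) <= N m / zeta.
  apply: (@le_trans _ _ (N m)).
    by rewrite ler_nat (leq_trans MK)// leq_pmull.
  by rewrite ler_peMr// -[1]invr1 lef_pV2 ?posrE// ltW.
rewrite -[leLHS]expRK ler_ln ?posrE ?expR_gt0//.
  exact: le_trans (ltW expM) KN.
by rewrite (lt_le_trans _ KN)// ltr0n.
Qed.
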